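(* Let $\mathcal{A}$ be a small abelian length category and let $\mathcal{T}:\ 0=\mathcal{T}_0\lessdot \mathcal{T}_1\lessdot\cdots\lessdot\mathcal{T}_m=\mathcal{A}$ be a maximal green sequence in $\mathcal{A}$. Then $\mathcal{T}$ can be induced by some central charge $Z:K_0(\mathcal{A})\to\mathbb{C}$ if and only if $\mathcal{T}$ satisfies crossing inequalities.
   Context: An abelian length category is an abelian category in which every object has finite length. A torsion class in $\mathcal{A}$ is a full subcategory closed under isomorphisms, extensions and factors. For torsion classes, $\mathcal{T}\lessdot\mathcal{T}'$ means $\mathcal{T}\subsetneq\mathcal{T}'$ and every torsion class $\mathcal{X}$ with $\mathcal{T}\subset\mathcal{X}\subset\mathcal{T}'$ equals $\mathcal{T}$ or $\mathcal{T}'$. A maximal green sequence in $\mathcal{A}$ is a finite sequence of torsion classes $\mathcal{T}_0\lessdot\mathcal{T}_1\lessdot\cdots\lessdot\mathcal{T}_m$ with $\mathcal{T}_0=0$, $\mathcal{T}_m=\mathcal{A}$. If one exists, $\mathcal{A}$ has finitely many simple objects $S_1,\dots,S_n$ up to isomorphism, and $K_0(\mathcal{A})\cong\mathbb{Z}^n$ with basis $[S_1],\dots,[S_n]$; $[X]\in\mathbb{Z}^n$ denotes the class of $X$. For $\theta\in\mathbb{R}^n$ write $\langle\theta,X\rangle=\langle\theta,[X]\rangle$ (canonical inner product on $\mathbb{R}^n$). A brick is an object whose endomorphism ring is a division ring. For a set (or class) $\mathcal{S}$ of objects, $Filt(\mathcal{S})$ is the full subcategory of objects having a finite filtration whose subquotients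 are isomorphic to indecomposable objects of $\mathcal{S}$. An object $M$ is a minimal extending object for a torsion class $\mathcal{T}$ if (i) every proper factor of $M$ is in $\mathcal{T}$; (ii) if $0\to M\to X\to T\to 0$ is a non-split exact sequence with $T\in\mathcal{T}$, then $X\in\mathcal{T}$; (iii) $\mathrm{Hom}(\mathcal{T},M)=0$. For each cover $\mathcal{T}\lessdot\mathcal{T}'$ there is, up to isomorphism, a unique indecomposable $M$ that is a minimal extending object for $\mathcal{T}$ with $\mathcal{T}'=Filt(\mathcal{T}\cup\{M\})$. The complete forward hom-orthogonal sequence corresponding to the maximal green sequence $\mathcal{T}$ is the sequence of bricks $N_1,\dots,N_m$ where $N_i$ is the minimal extending object of $\mathcal{T}_{i-1}$ with $\mathcal{T}_i=Filt(\mathcal{T}_{i-1}\cup\{N_i\})$. Crossing inequalities: $\mathcal{T}$ satisfies crossing inequalities if there exist vectors $\alpha\in\mathbb{R}^n$ and $\beta\in\mathbb{R}^n_{>0}$ such that $\langle\alpha,N_i\rangle\langle\beta,N_{i+1}\rangle<\langle\alpha,N_{i+1}\rangle\langle\beta,N_i\rangle$ for all $1\le i\le m-1$. A central charge on $\mathcal{A}$ is an additive map $Z:K_0(\mathcal{A})\to\mathbb{C}$ of the form $Z(X)=\langle\alpha,[X]\rangle+\mathrm{i}\langle\beta,[X]\rangle$ with $\alpha\in\mathbb{R}^n$, $\beta\in\mathbb{R}^n_{>0}$ fixed. It determines the stability function $\phi_Z:\mathcal{A}\setminus\{0\}\to[0,1]$, $\phi_Z(X)=\frac{\arg Z(X)}{\pi}$.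 Given a stability function $\phi:\mathcal{A}\setminus\{0\}\to\mathcal{P}$ ($\mathcal{P}$ totally ordered; $\phi$ constant on isomorphism classes; for each short exact sequence $0\to L\to M\to N\to0$ of nonzero objects, $\phi(L),\phi(M),\phi(N)$ are all equal, or strictly increasing, or strictly decreasing), a nonzero $M$ is $\phi$-semistable if $\phi(L)\le\phi(M)$ for every nontrivial subobject $L\subset M$. Every nonzero $X$ has a unique (up to isomorphism) Harder–Narasimhan filtration $0=X_0\subsetneq X_1\subsetneq\cdots\subsetneq X_l=X$ with $F_j=X_j/X_{j-1}$ semistable and $\phi(F_1)>\cdots>\phi(F_l)$; $F_l$ is the maximally destabilizing quotient of $X$. For $p\in\mathcal{P}$, $\mathcal{T}_{\ge p}$ is the torsion class consisting of $0$ and all nonzero $X$ whose maximally destabilizing quotient $X'$ satisfies $\phi(X')\ge p$. A maximal green sequence $\mathcal{T}_0\lessdot\cdots\lessdot\mathcal{T}_m$ is induced by $\phi$ if the chain of torsion classes $\{\mathcal{T}_{\ge r}\}_{r\in\mathcal{P}}$ forms this maximal green sequence, i.e. $\{\mathcal{T}_{\ge r}: r\in\mathcal{P}\}=\{\mathcal{T}_0,\dots,\mathcal{T}_m\}$. It is induced by a central charge $Z$ if it is induced by $\phi_Z$. *)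

(* Defs.v *)
From Corelib Require Import ListDef.
From HB Require Import structures.
From mathcomp Require Import all_boot all_order all_algebra.
From mathcomp Require Import boolp classical_sets set_interval reals trigo.
From mathcomp Require Import complex freeg.

Set Implicit Arguments.
Unset Strict Implicit.
Unset Printing Implicit Defensive.

Import Order.TTheory GRing.Theory Num.Theory.
Local Open Scope classical_set_scope.
Local Open Scope ring_scope.

(* Small categories enriched in abelian groups. [compm g f] is "g after f".
   The choice structure carried by [zmodType] is no restriction, by
   [gen_choiceMixin]. *)
Record preadditive := Preadditive {
  ob :> Type;
  mor : ob -> ob -> zmodType;
  idm : forall X, mor X X;
  compm : forall X Y Z, mor Y Z -> mor X Y -> mor X Z;
  compA : forall W X Y Z (h : mor Y Z) (g : mor X Y) (f : mor W X),
    compm h (compm g f) = compm (compm h g) f;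
  comp1m : forall X Y (f : mor X Y), compm (idm Y) f = f;
  compm1 : forall X Y (f : mor X Y), compm f (idm X) = f;
  compDl : forall X Y Z (g1 g2 : mor Y Z) (f : mor X Y),
    compm (g1 + g2) f = compm g1 f + compm g2 f;
  compDr : forall X Y Z (g : mor Y Z) (f1 f2 : mor X Y),
    compm g (f1 + f2) = compm g f1 + compm g f2
}.

Section Abelian.
Variable A : preadditive.
Implicit Types X Y Z : A.

Definition is_zero X : Prop :=
  forall Y, (forall f : mor X Y, f = 0) /\ (forall f : mor Y X, f = 0).

Definition is_mono X Y (f : mor X Y) : Prop :=
  forall W (g h : mor W X), compm f g = compm f h -> g = h.

Definition is_epi X Y (f : mor X Y) : Prop :=
  forall W (g h : mor Y W), compm g f = compm h f -> g = h.

Definition is_iso X Y (f : mor X Y) : Prop :=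
  exists g : mor Y X, compm g f = idm X /\ compm f g = idm Y.

Definition isomorphic X Y : Prop := exists f : mor X Y, is_iso f.

Definition is_kernel X Y K (f : mor X Y) (k : mor K X) : Prop :=
  compm f k = 0 /\
  forall W (h : mor W X), compm f h = 0 -> exists! u : mor W K, compm k u = h.

Definition is_cokernel X Y C (f : mor X Y) (c : mor Y C) : Prop :=
  compm c f = 0 /\
  forall W (h : mor Y W), compm h f = 0 -> exists! u : mor C W, compm u c = h.

Definition is_biproduct X Y P : Prop :=
  exists (i1 : mor X P) (i2 : mor Y P) (p1 : mor P X) (p2 : mor P Y),
    [/\ compm p1 i1 = idm X, compm p2 i2 = idm Y, compm p1 i2 = 0,
        compm p2 i1 = 0 & compm i1 p1 + compm i2 p2 = idm P].

Record abelian : Prop := Abelian {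
  has_zero : exists X, is_zero X;
  has_biproducts : forall X Y, exists P, is_biproduct X Y P;
  has_kernels : forall X Y (f : mor X Y), exists K (k : mor K X), is_kernel f k;
  has_cokernels : forall X Y (f : mor X Y),
    exists C (c : mor Y C), is_cokernel f c;
  mono_normal : forall X Y (f : mor X Y), is_mono f ->
    exists Z (g : mor Y Z), is_kernel g f;
  epi_conormal : forall X Y (f : mor X Y), is_epi f ->
    exists Z (g : mor Z X), is_cokernel g f
}.

Definition short_exact L M N (f : mor L M) (g : mor M N) : Prop :=
  is_kernel g f /\ is_cokernel f g.

Definition split_exact L M N (f : mor L M) (g : mor M N) : Prop :=
  short_exact f g /\ exists s : mor N M, compm g s = idm N.

Definition is_simple X : Prop :=
  ~ is_zero X /\
  forall L (f : mor L X), is_mono f -> is_zero L \/ is_iso f.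

Definition indecomposable X : Prop :=
  ~ is_zero X /\
  forall Y Z, is_biproduct Y Z X -> is_zero Y \/ is_zero Z.

(* The endomorphism ring is a division ring. *)
Definition brick X : Prop :=
  idm X <> 0 /\ forall f : mor X X, f <> 0 -> is_iso f.

(* [filtration X [:: F_1; ...; F_l]]: there is a chain of subobjects
   0 = X_0 <= X_1 <= ... <= X_l = X with X_j / X_(j-1) isomorphic to F_j
   (the inclusions are strict iff no F_j is zero). *)
Inductive filtration : A -> seq A -> Prop :=
| Filtration0 X : is_zero X -> filtration X [::]
| FiltrationS L M N (f : mor L M) (g : mor M N) s :
    short_exact f g -> filtration L s -> filtration M (rcons s N).

Definition length_category : Prop :=
  forall X, exists s, filtration X s /\ Forall is_simple s.

Definition Filt (C : set A) : set A := [set X | exists s, filtration X s /\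
  Forall (fun F => exists G, [/\ C G, indecomposable G & isomorphic F G]) s].

Record torsion_class (T : set A) : Prop := TorsionClass {
  torsion_iso : forall X Y, isomorphic X Y -> T X -> T Y;
  torsion_ext : forall L M N (f : mor L M) (g : mor M N),
    short_exact f g -> T L -> T N -> T M;
  torsion_factor : forall X Y (f : mor X Y), is_epi f -> T X -> T Y
}.

Definition torsion_cover (T T' : set A) : Prop :=
  [/\ torsion_class T, torsion_class T', T `<` T' &
      forall U, torsion_class U -> T `<=` U -> U `<=` T' -> U = T \/ U = T'].

(* Only the classes T 0, ..., T m matter; likewise, only N 1, ..., N m matter
   in [hom_orthogonal_sequence]. *)
Definition maximal_green_sequence (m : nat) (T : nat -> set A) : Prop :=
  [/\ T 0%N = [set X | is_zero X], T m = setT, forall i, (i <= m)%N -> torsion_class (T i) &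
      forall i, (i < m)%N -> torsion_cover (T i) (T i.+1)].

Definition minimal_extending (T : set A) (M : A) : Prop :=
  [/\ forall Q (q : mor M Q), is_epi q -> ~ is_iso q -> T Q,
      forall X Y (f : mor M X) (g : mor X Y),
        T Y -> short_exact f g -> ~ split_exact f g -> T X &
      forall Y (f : mor Y M), T Y -> f = 0].

Definition hom_orthogonal_sequence (m : nat) (T : nat -> set A) (N : nat -> A) :
    Prop :=
  forall i, (i < m)%N ->
    [/\ brick (N i.+1), minimal_extending (T i) (N i.+1) &
        T i.+1 = Filt (T i `|` [set N i.+1])].

End Abelian.

(* The Grothendieck group: the free abelian group on the objects modulo the
   subgroup generated by [M] - [L] - [N] for short exact 0 -> L -> M -> N -> 0. *)
Section Grothendieck.
Variable A : preadditive.

Definition fobj (X : A) : {freeg {classic A} / int} := << (X : {classic A}) >>.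

Inductive K0_relation : {freeg {classic A} / int} -> Prop :=
| K0rel0 : K0_relation 0
| K0relB x y : K0_relation x -> K0_relation y -> K0_relation (x - y)
| K0rel_exact L M N (f : mor L M) (g : mor M N) :
    short_exact f g -> K0_relation (fobj M - fobj L - fobj N).

Definition K0_ideal : {pred {freeg {classic A} / int}} :=
  fun x => `[< K0_relation x >].

Lemma K0_ideal_zmod_closed : zmod_closed K0_ideal.
Proof.
split=> [|x y]; first by apply/asboolP; exact: K0rel0.
by move=> /asboolP hx /asboolP hy; apply/asboolP; exact: K0relB.
Qed.

HB.instance Definition _ :=
  GRing.isZmodClosed.Build _ K0_ideal K0_ideal_zmod_closed.

Definition K0 : zmodType := Quotient.quot K0_ideal.

Definition K0class (X : A) : K0 := \pi_(Quotient.quot K0_ideal)%qT (fobj X).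

End Grothendieck.

Section Classes.
Variables (R : realType) (A : preadditive) (n : nat) (S : 'I_n -> A).

Definition enumerates_simples : Prop :=
  [/\ forall i, is_simple (S i), forall i j, isomorphic (S i) (S j) -> i = j &
      forall X : A, is_simple X -> exists i, isomorphic X (S i)].

(* [X] as a vector of Z^n: the coordinates of its class in the basis
   [S_1], ..., [S_n] of K0. *)
Definition dimvec (X : A) : 'rV[int]_n :=
  xget 0 [set v : 'rV[int]_n |
    K0class X = \sum_(i < n) K0class (S i) *~ v 0 i].

Definition pairing (theta : 'rV[R]_n) (X : A) : R :=
  \sum_(i < n) theta 0 i * (dimvec X 0 i)%:~R.

Definition positive_vector (beta : 'rV[R]_n) : Prop := forall i, 0 < beta 0 i.

Definition crossing_inequalities (m : nat) (T : nat -> set A) : Prop :=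
  exists N, hom_orthogonal_sequence m T N /\
  exists alpha beta, positive_vector beta /\
    forall i, (0 < i < m)%N ->
      pairing alpha (N i) * pairing beta (N i.+1)
        < pairing alpha (N i.+1) * pairing beta (N i).

Definition central_charge (Z : {additive K0 A -> R[i]}) : Prop :=
  exists alpha beta, positive_vector beta /\
    forall X, Z (K0class X) = (pairing alpha X +i* pairing beta X)%C.

End Classes.

Arguments crossing_inequalities R {A n} S m T.

(* A stability function with values in the totally ordered set D (a subset of
   the ordered type P); its values at zero objects are irrelevant. *)
Section Stability.
Variables (A : preadditive) (d : Order.disp_t) (P : orderType d).
Variables (D : set P) (phi : A -> P).
Local Open Scope order_scope.

Record stability_function : Prop := StabilityFunction {
  stab_codom : forall X, ~ is_zero X -> D (phi X);
  stab_iso : forall X Y, ~ is_zero X -> isomorphic X Y -> phi X = phi Y;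
  stab_exact : forall L M N (f : mor L M) (g : mor M N), short_exact f g ->
    ~ is_zero L -> ~ is_zero M -> ~ is_zero N ->
    [\/ phi L = phi M /\ phi M = phi N,
        phi L < phi M /\ phi M < phi N |
        phi L > phi M /\ phi M > phi N]
}.

Definition semistable (M : A) : Prop :=
  ~ is_zero M /\
  forall L (f : mor L M), is_mono f -> ~ is_zero L -> phi L <= phi M.

Definition harder_narasimhan (X : A) (s : seq A) : Prop :=
  [/\ filtration X s, Forall semistable s & sorted (fun F G => phi F > phi G) s].

Definition max_destabilizing_quotient (X F : A) : Prop :=
  exists s, harder_narasimhan X (rcons s F).

Definition torsion_ge (p : P) : set A := [set X | is_zero X \/
  (~ is_zero X /\ exists F, max_destabilizing_quotient X F /\ p <= phi F)].

Definition induced_by (m : nat) (T : nat -> set A) : Prop :=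
  stability_function /\
  [set torsion_ge p | p in D] = [set T i | i in [set i | (i <= m)%N]].

End Stability.

Section CentralCharge.
Variables (R : realType) (A : preadditive).

(* The principal argument in ]-pi, pi] of a nonzero z. *)
Definition arg (z : R[i]) : R :=
  let a := acos (complex.Re z / Num.sqrt (complex.Re z ^+ 2 + complex.Im z ^+ 2)) in
  if 0 <= complex.Im z then a else - a.

Definition phase (Z : {additive K0 A -> R[i]}) (X : A) : R :=
  arg (Z (K0class X)) / pi.

Definition induced_by_charge (Z : {additive K0 A -> R[i]}) (m : nat)
    (T : nat -> set A) : Prop :=
  induced_by `[0, 1] (phase Z) m T.

End CentralCharge.

(* Main.v *)
From HB Require Import structures.
Require Import Defs.
From mathcomp Require Import all_boot all_order all_algebra.
From mathcomp Require Import boolp classical_sets reals complex.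
From mathcomp Require Import trigo freeg.
From mathcomp Require Import zify lra.

Set Implicit Arguments.
Unset Strict Implicit.
Unset Printing Implicit Defensive.

Import Order.TTheory GRing.Theory Num.Theory.
Local Open Scope classical_set_scope.
Local Open Scope ring_scope.

Local Notation "g ** f" := (compm g f) (at level 40, left associativity).
Local Notation compA := Defs.compA.
Local Notation Forall := ListDef.Forall.

(** Why the theorem holds.

    Attach to a cover [T] below [T'] an object [N] of [T'] outside [T], of least
    length. Every proper factor of [N] is in [T], and the fact that nothing lies
    strictly between [T] and [T'] forces [N] to be a brick, a minimal extending
    object for [T], and such that [T'] is [Filt (T `|` [set N])]
    ([cover_minimal_extending]). So the bricks N_1, ..., N_m exist. Phases compare
    as slopes alpha / beta in reverse order: the phase of [X] is at most that of
    [Y] iff alpha(Y) beta(X) <= alpha(X) beta(Y) ([le_phase]). The crossing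
    inequalities thus say exactly that the phases of N_1, ..., N_m strictly
    decrease.

    If a charge induces the sequence, then T_i is some T_(>= p_i). The maximally
    destabilizing quotient of N_i cannot be a proper factor of N_i, since it
    would be in T_(i-1) and put N_i there; so N_i is semistable, and its phase
    is at least p_i and less than p_(i-1) ([minimal_extending_phase]). Hence
    the phases decrease.

    Conversely, suppose that they decrease. An object of T_i with no nonzero map
    from T_(i-1) is an iterated extension of copies of N_i
    ([minimal_extending_free]), so it has the phase of N_i; an object of T_i is
    filtered by such layers of indices j <= i, so its phase is at least that of
    N_i ([green_slope_ge]). Applied to the factors of a layer, this shows that
    layers are semistable; the filtration of an object by its layers is
    then a Harder-Narasimhan filtration, and T_(>= p) is T_i for the last i
    such that the phase of N_i is at least p ([torsion_ge_green]).

    Both directions need dimension vectors to be additive and nonzero on nonzero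
    objects, which is the Jordan-Hölder theorem ([jordan_holder], [dimvecE]). *)

(** * Morphisms in preadditive categories *)

Section Preadditive.
Variable A : preadditive.
Implicit Types X Y Z W : A.

Lemma comp0m X Y Z (f : mor X Y) : (0 : mor Y Z) ** f = 0.
Proof. by apply: (addrI (0 ** f)); rewrite -compDl !addr0. Qed.

Lemma compm0 X Y Z (g : mor Y Z) : g ** (0 : mor X Y) = 0.
Proof. by apply: (addrI (g ** 0)); rewrite -compDr !addr0. Qed.

Lemma compBl X Y Z (g1 g2 : mor Y Z) (f : mor X Y) :
  (g1 - g2) ** f = g1 ** f - g2 ** f.
Proof. by apply: (addIr (g2 ** f)); rewrite -compDl !subrK. Qed.

Lemma compBr X Y Z (g : mor Y Z) (f1 f2 : mor X Y) :
  g ** (f1 - f2) = g ** f1 - g ** f2.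
Proof. by apply: (addIr (g ** f2)); rewrite -compDr !subrK. Qed.

Lemma is_zeroP X : is_zero X <-> idm X = 0.
Proof.
split=> [/(_ X)[X0 _]|X0 Y]; [exact: X0|split=> f].
  by rewrite -(compm1 f) X0 compm0.
by rewrite -(comp1m f) X0 comp0m.
Qed.

Lemma from_zero X Y (f : mor X Y) : is_zero X -> f = 0.
Proof. by move=> /(_ Y)[]. Qed.

Lemma to_zero X Y (f : mor X Y) : is_zero Y -> f = 0.
Proof. by move=> /(_ X)[]. Qed.

Lemma is_monoP X Y (f : mor X Y) :
  is_mono f <-> forall W (h : mor W X), f ** h = 0 -> h = 0.
Proof.
split=> [fm W h fh0|f0 W g h fgh].
  by apply: fm; rewrite fh0 compm0.
by apply/eqP; rewrite -subr_eq0; apply/eqP/f0; rewrite compBr fgh subrr.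
Qed.

Lemma is_epiP X Y (f : mor X Y) :
  is_epi f <-> forall W (h : mor Y W), h ** f = 0 -> h = 0.
Proof.
split=> [fe W h fh0|f0 W g h fgh].
  by apply: fe; rewrite fh0 comp0m.
by apply/eqP; rewrite -subr_eq0; apply/eqP/f0; rewrite compBl fgh subrr.
Qed.

Lemma kernel_mono X Y K (f : mor X Y) (k : mor K X) :
  is_kernel f k -> is_mono k.
Proof.
move=> [fk0 kU]; apply/is_monoP => W h kh0.
have [|u [_ uU]] := kU W 0; first by rewrite compm0.
by rewrite -(uU h kh0); apply: uU; rewrite compm0.
Qed.

Lemma cokernel_epi X Y C (f : mor X Y) (c : mor Y C) :
  is_cokernel f c -> is_epi c.
Proof.
move=> [cf0 cU]; apply/is_epiP => W h hc0.
have [|u [_ uU]] := cU W 0; first by rewrite comp0m.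
by rewrite -(uU h hc0); apply: uU; rewrite comp0m.
Qed.

Lemma kernel_lift X Y K (f : mor X Y) (k : mor K X) :
  is_kernel f k -> forall W (h : mor W X), f ** h = 0 -> exists u, k ** u = h.
Proof. by move=> [_ kU] W h /kU[u [uh _]]; exists u. Qed.

Lemma cokernel_desc X Y C (f : mor X Y) (c : mor Y C) :
  is_cokernel f c -> forall W (h : mor Y W), h ** f = 0 -> exists u, u ** c = h.
Proof. by move=> [_ cU] W h /cU[u [uh _]]; exists u. Qed.

(** Lifts along a mono are unique, so the uniqueness clause of [is_kernel] comes
    for free. *)
Lemma mono_is_kernel X Y K (f : mor X Y) (k : mor K X) :
  is_mono k -> f ** k = 0 ->
  (forall W (h : mor W X), f ** h = 0 -> exists u, k ** u = h) -> is_kernel f k.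
Proof.
move=> km fk0 kU; split=> // W h /kU[u uh]; exists u; split=> // v vh.
by apply: km; rewrite uh vh.
Qed.

Lemma epi_is_cokernel X Y C (f : mor X Y) (c : mor Y C) :
  is_epi c -> c ** f = 0 ->
  (forall W (h : mor Y W), h ** f = 0 -> exists u, u ** c = h) ->
  is_cokernel f c.
Proof.
move=> ce cf0 cU; split=> // W h /cU[u uh]; exists u; split=> // v vh.
by apply: ce; rewrite uh vh.
Qed.

Lemma mono_comp X Y Z (g : mor Y Z) (f : mor X Y) :
  is_mono g -> is_mono f -> is_mono (g ** f).
Proof. by move=> gm fm W h k; rewrite -!compA => /gm/fm. Qed.

Lemma epi_comp X Y Z (g : mor Y Z) (f : mor X Y) :
  is_epi g -> is_epi f -> is_epi (g ** f).
Proof. by move=> ge fe W h k; rewrite !compA => /fe/ge. Qed.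

Lemma mono_cancel X Y Z (g : mor Y Z) (f : mor X Y) :
  is_mono (g ** f) -> is_mono f.
Proof. by move=> m W h k fhk; apply: m; rewrite -!compA fhk. Qed.

Lemma epi_cancel X Y Z (g : mor Y Z) (f : mor X Y) :
  is_epi (g ** f) -> is_epi g.
Proof. by move=> e W h k fhk; apply: e; rewrite !compA fhk. Qed.

Lemma idm_mono X : is_mono (idm X).
Proof. by move=> W g h; rewrite !comp1m. Qed.

Lemma idm_epi X : is_epi (idm X).
Proof. by move=> W g h; rewrite !compm1. Qed.

Lemma iso_mono X Y (f : mor X Y) : is_iso f -> is_mono f.
Proof.
by move=> [g [gf _]]; apply: (@mono_cancel _ _ _ g); rewrite gf; exact: idm_mono.
Qed.

Lemma iso_epi X Y (f : mor X Y) : is_iso f -> is_epi f.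
Proof.
by move=> [g [_ fg]]; apply: (@epi_cancel _ _ _ _ g); rewrite fg; exact: idm_epi.
Qed.

Lemma isomorphic_refl X : isomorphic X X.
Proof. by exists (idm X), (idm X); rewrite comp1m. Qed.

Lemma isomorphic_sym X Y : isomorphic X Y -> isomorphic Y X.
Proof. by move=> [f [g [gf fg]]]; exists g, f. Qed.

Lemma isomorphic_trans Y X Z :
  isomorphic X Y -> isomorphic Y Z -> isomorphic X Z.
Proof.
move=> [f [f' [f'f ff']]] [g [g' [g'g gg']]]; exists (g ** f), (f' ** g').
split; first by rewrite -compA (compA g') g'g comp1m.
by rewrite -compA (compA f) ff' comp1m.
Qed.

Lemma mono_to_zero X Y (f : mor X Y) : is_mono f -> is_zero Y -> is_zero X.
Proof.
by move=> /is_monoP fm Y0; apply/is_zeroP/fm; rewrite compm1; exact: to_zero.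
Qed.

Lemma epi_from_zero X Y (f : mor X Y) : is_epi f -> is_zero X -> is_zero Y.
Proof.
by move=> /is_epiP fe X0; apply/is_zeroP/fe; rewrite comp1m; exact: from_zero.
Qed.

Lemma isomorphic_zero X Y : isomorphic X Y -> is_zero X -> is_zero Y.
Proof. by move=> [f /iso_epi fe]; exact: epi_from_zero fe. Qed.

Lemma isomorphic_nonzero X Y : isomorphic X Y -> ~ is_zero X -> ~ is_zero Y.
Proof. by move=> /isomorphic_sym XY X0 /(isomorphic_zero XY). Qed.

Section ShortExact.
Variables (L M N : A) (f : mor L M) (g : mor M N).
Hypothesis fg : short_exact f g.

Lemma ses_mono : is_mono f. Proof. exact: (kernel_mono fg.1). Qed.
Lemma ses_epi : is_epi g. Proof. exact: (cokernel_epi fg.2). Qed.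
Lemma ses_comp : g ** f = 0. Proof. by case: fg => -[]. Qed.

Lemma ses_zero_mid : is_zero M -> is_zero L /\ is_zero N.
Proof.
move=> M0; split; first exact: mono_to_zero ses_mono _.
exact: epi_from_zero ses_epi _.
Qed.

Lemma ses_iso_sub : is_zero N -> is_iso f.
Proof.
move=> N0; have [u fu] : exists u, f ** u = idm M.
  by apply: (kernel_lift fg.1); exact: to_zero.
exists u; split=> //; apply: ses_mono.
by rewrite compA fu comp1m compm1.
Qed.

Lemma ses_iso_quot : is_zero L -> is_iso g.
Proof.
move=> L0; have [u ug] : exists u, u ** g = idm M.
  by apply: (cokernel_desc fg.2); exact: from_zero.
exists u; split=> //; apply: ses_epi.
by rewrite -compA ug compm1 comp1m.
Qed.

Lemma ses_iso_mid M' (p : mor M M') (q : mor M' M) :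
  q ** p = idm M -> p ** q = idm M' -> short_exact (p ** f) (g ** q).
Proof.
move=> qp pq; split.
- apply: mono_is_kernel => [||W h gqh].
  + by apply: mono_comp ses_mono; apply: iso_mono; exists q.
  + by rewrite -compA (compA q) qp comp1m ses_comp.
  + have [|u fu] := kernel_lift fg.1 (h := q ** h); first by rewrite compA.
    by exists u; rewrite -compA fu compA pq comp1m.
- apply: epi_is_cokernel => [||W h hpf].
  + by apply: epi_comp; [exact: ses_epi|apply: iso_epi; exists p].
  + by rewrite -compA (compA q) qp comp1m ses_comp.
  + have [|u ug] := cokernel_desc fg.2 (h := h ** p); first by rewrite -compA.
    by exists u; rewrite compA ug -compA pq compm1.
Qed.

End ShortExact.

Lemma biproduct_ses Y Z X : is_biproduct Y Z X ->
  exists (i : mor Y X) (p : mor X Z), short_exact i p.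
Proof.
move=> [i1 [i2 [p1 [p2 [p1i1 p2i2 p1i2 p2i1 ip]]]]]; exists i1, p2; split.
- apply: mono_is_kernel => // [|W h p2h].
    by apply: (@mono_cancel _ _ _ p1); rewrite p1i1; exact: idm_mono.
  exists (p1 ** h).
  by rewrite -[RHS]comp1m -ip compDl -(compA i2) p2h compm0 addr0 compA.
- apply: epi_is_cokernel => // [|W h hi1].
    by apply: (@epi_cancel _ _ _ _ i2); rewrite p2i2; exact: idm_epi.
  exists (h ** i2).
  by rewrite -[RHS]compm1 -ip compDr (compA h i1) hi1 comp0m add0r compA.
Qed.

Lemma biproduct_sym Y Z X : is_biproduct Y Z X -> is_biproduct Z Y X.
Proof.
move=> [i1 [i2 [p1 [p2 [p1i1 p2i2 p1i2 p2i1 ip]]]]].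
by exists i2, i1, p2, p1; split=> //; rewrite addrC.
Qed.

(** The idempotent of a direct summand is zero or invertible. *)
Lemma brick_indecomposable X : brick X -> indecomposable X.
Proof.
move=> [X1 Xiso]; split=> [/is_zeroP //|Y Z].
move=> [i1 [i2 [p1 [p2 [p1i1 p2i2 p1i2 p2i1 ip]]]]].
have [ip0|ip_neq0] := EM (i1 ** p1 = 0).
  left; apply/is_zeroP; rewrite -p1i1 -[i1]compm1 -{1}p1i1.
  by rewrite (compA i1) ip0 comp0m compm0.
right; apply/is_zeroP; rewrite -p2i2.
suff -> : i2 = 0 by rewrite compm0.
apply/(iso_mono (Xiso _ ip_neq0)); by rewrite compm0 -compA p1i2 compm0.
Qed.

End Preadditive.

(** * Abelian categories *)

Section AbelianCategory.
Variable A : preadditive.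
Hypothesis hab : abelian A.
Implicit Types X Y Z W : A.

Lemma mono_epi_iso X Y (f : mor X Y) : is_mono f -> is_epi f -> is_iso f.
Proof.
move=> fm fe; have [Z [g fK]] := mono_normal hab fm.
have g0 : g = 0 by apply/(is_epiP f).1 => //; case: fK.
have [|u fu] := kernel_lift fK (h := idm Y); first by rewrite g0 comp0m.
by exists u; split=> //; apply: fm; rewrite compA fu comp1m compm1.
Qed.

Lemma epi_cokernel X Y K (f : mor X Y) (k : mor K X) :
  is_epi f -> is_kernel f k -> is_cokernel k f.
Proof.
move=> fe fk; have [Z [g gf]] := epi_conormal hab fe.
apply: epi_is_cokernel => //; first by case: fk.
move=> W h hk0; apply: (cokernel_desc gf).
have [|u <-] := kernel_lift fk (h := g); first by case: gf.
by rewrite compA hk0 comp0m.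
Qed.

Lemma mono_kernel X Y C (f : mor X Y) (c : mor Y C) :
  is_mono f -> is_cokernel f c -> is_kernel c f.
Proof.
move=> fm fc; have [Z [g gf]] := mono_normal hab fm.
apply: mono_is_kernel => //; first by case: fc.
move=> W h ch0; apply: (kernel_lift gf).
have [|u <-] := cokernel_desc fc (h := g); first by case: gf.
by rewrite -compA ch0 compm0.
Qed.

Lemma epi_ses X Y (f : mor X Y) :
  is_epi f -> exists K (k : mor K X), short_exact k f.
Proof.
move=> fe; have [K [k fk]] := has_kernels hab f.
by exists K, k; split=> //; exact: epi_cokernel.
Qed.

Lemma mono_ses X Y (f : mor X Y) :
  is_mono f -> exists C (c : mor Y C), short_exact f c.
Proof.
move=> fm; have [C [c fc]] := has_cokernels hab f.
by exists C, c; split=> //; exact: mono_kernel.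
Qed.

Lemma zero_ses X : exists K (k : mor K X), is_zero K /\ short_exact k (idm X).
Proof.
have [K [k kX]] := epi_ses (@idm_epi _ X); exists K, k; split=> //.
apply/is_zeroP; apply: (ses_mono kX); rewrite compm0 compm1.
by rewrite -(ses_comp kX) comp1m.
Qed.

(** The image is the kernel of the cokernel. That the corestriction is epi
    follows from normality of monos: if [h] kills it, then [ker h] is again a
    subobject of [Y] through which [f] factors, hence contains the image. *)
Lemma image_factorization X Y (f : mor X Y) : exists I (e : mor X I) (i : mor I Y),
  [/\ is_epi e, is_mono i & f = i ** e].
Proof.
have [C [c fc]] := has_cokernels hab f.
have [I [i ci]] := has_kernels hab c.
have im := kernel_mono ci.
have [|e ie] := kernel_lift ci (h := f); first by case: fc.
exists I, e, i; split=> //; apply/is_epiP => W h he0.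
have [K [k hk]] := has_kernels hab h.
have [e' ke] := kernel_lift hk he0.
have ikm := mono_comp im (kernel_mono hk).
have [Z [p pik]] := mono_normal hab ikm.
have [|p' pc] := cokernel_desc fc (h := p).
  by rewrite -ie -ke !compA -(compA p) pik.1 comp0m.
have [|v ikv] := kernel_lift pik (h := i).
  by rewrite -pc -compA ci.1 compm0.
have kv : k ** v = idm I by apply: im; rewrite compA ikv compm1.
by rewrite -[h]compm1 -kv compA hk.1 comp0m.
Qed.

(** The preimage [P] in [M] of a subobject [N'] of [N = M / L]: it is an
    extension of [N'] by [L], and [M / P] is [N / N'] (third isomorphism
    theorem). *)
Lemma preimage_ses L M N N' C (f : mor L M) (g : mor M N)
    (i : mor N' N) (q : mor N C) :
  short_exact f g -> short_exact i q ->
  exists (P : A) (f' : mor L P) (e : mor P N') (j : mor P M),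
    [/\ short_exact f' e, short_exact j (q ** g), j ** f' = f & g ** j = i ** e].
Proof.
move=> fg iq; have qge := epi_comp (ses_epi iq) (ses_epi fg).
have [P [j jqg]] := epi_ses qge.
have [|e ie] := kernel_lift iq.1 (h := g ** j).
  by rewrite compA (ses_comp jqg).
have [|f' jf] := kernel_lift jqg.1 (h := f).
  by rewrite -compA (ses_comp fg) compm0.
exists P, f', e, j; split=> //.
have ef0 : e ** f' = 0.
  by apply: (ses_mono iq); rewrite compA ie -compA jf (ses_comp fg) compm0.
have f'e : is_kernel e f'.
  apply: mono_is_kernel => // [|W h eh0].
    by apply: (@mono_cancel _ _ _ _ j); rewrite jf; exact: ses_mono fg.
  have [|u fu] := kernel_lift fg.1 (h := j ** h).
    by rewrite compA -ie -compA eh0 compm0.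
  by exists u; apply: (ses_mono jqg); rewrite compA jf.
split=> //; apply: epi_cokernel => //.
(* the image [I] of [e] is all of [N']: the quotient of [N] by [I] factors
   through the quotient by [N'] *)
have [I [e' [k [e'e km ek]]]] := image_factorization e.
have [C' [q' ikq]] := mono_ses (mono_comp (ses_mono iq) km).
have [|r rq] := cokernel_desc jqg.2 (h := q' ** g).
  by rewrite -compA -ie ek !compA -(compA q') (ses_comp ikq) comp0m.
have q'r : q' = r ** q by apply: (ses_epi fg); rewrite -compA.
have [|v kv] := kernel_lift ikq.1 (h := i).
  by rewrite q'r -compA (ses_comp iq) compm0.
have {}kv : k ** v = idm N'.
  by apply: (ses_mono iq); rewrite compA kv compm1.
rewrite ek; apply: epi_comp => //.
by apply: (@epi_cancel _ _ _ _ _ v); rewrite kv; exact: idm_epi.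
Qed.

Lemma simple_mono X Y (f : mor X Y) : is_simple X -> f <> 0 -> is_mono f.
Proof.
move=> [_ Xs] f0; have [K [k fk]] := has_kernels hab f.
case: (Xs _ _ (kernel_mono fk)) => [K0|/iso_epi ke].
  apply/is_monoP => W h /(kernel_lift fk)[u <-].
  by rewrite (to_zero u K0) compm0.
by case: f0; apply/(is_epiP k).1 => //; exact: fk.1.
Qed.

Lemma simple_epi X Y (f : mor X Y) : is_simple Y -> f <> 0 -> is_epi f.
Proof.
move=> [_ Ys] f0; have [I [e [i [ee im fE]]]] := image_factorization f.
case: (Ys _ _ im) => [I0|/iso_epi ie].
  by case: f0; rewrite fE (from_zero i I0) comp0m.
by rewrite fE; exact: epi_comp.
Qed.

(** Here [K] is the intersection of [L] and [L'] in [X]. In the Jordan-Hölder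
    theorem [L] and [L'] are distinct maximal subobjects, and this compares the
    composition series through [L] with those through [L']. *)
Lemma kernels_cap X L N L' N' (f : mor L X) (g : mor X N)
    (f' : mor L' X) (g' : mor X N') :
  short_exact f g -> short_exact f' g' ->
  is_epi (g' ** f) -> is_epi (g ** f') ->
  exists K (k : mor K L) (k' : mor K L'),
    short_exact k (g' ** f) /\ short_exact k' (g ** f').
Proof.
move=> fg fg' e e'; have [K [k kgf]] := epi_ses e.
have [|k' k'E] := kernel_lift fg'.1 (h := f ** k).
  by rewrite compA (ses_comp kgf).
exists K, k, k'; split=> //.
suff kk : is_kernel (g ** f') k' by split=> //; exact: epi_cokernel.
apply: mono_is_kernel => [||W h gfh].
- apply: (@mono_cancel _ _ _ _ f'); rewrite k'E.
  exact: mono_comp (ses_mono fg) (ses_mono kgf).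
- by rewrite -compA k'E compA (ses_comp fg) comp0m.
have [|v fv] := kernel_lift fg.1 (h := f' ** h); first by rewrite compA.
have [|u ku] := kernel_lift kgf.1 (h := v).
  by rewrite -compA fv compA (ses_comp fg') comp0m.
by exists u; apply: (ses_mono fg'); rewrite compA k'E -compA ku.
Qed.

End AbelianCategory.

(** * Filtrations and the Jordan-Hölder theorem *)

Lemma Forall_cat (T : Type) (P : T -> Prop) (s t : seq T) :
  Forall P (s ++ t) <-> Forall P s /\ Forall P t.
Proof.
elim: s => [|x s [IH1 IH2]] /=.
  by split=> [Pt|[]//]; split=> //; constructor.
split=> [H|[H Pt]]; inversion_clear H as [|y u Px Ps].
  by have [? ?] := IH1 Ps; split=> //; constructor.
by constructor=> //; exact: IH2.
Qed.

Lemma Forall_rcons (T : Type) (P : T -> Prop) (s : seq T) (x : T) :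
  Forall P (rcons s x) <-> Forall P s /\ P x.
Proof.
rewrite -cats1 Forall_cat; split=> -[Ps H]; split=> //.
  by inversion_clear H.
by constructor=> //; constructor.
Qed.

Section Filtrations.
Variable A : preadditive.
Implicit Types (X Y Z L M N : A) (s t : seq A).

Lemma filtration0_inv X : filtration X [::] -> is_zero X.
Proof.
move E: [::] => s XF; case: XF E => // L M N f g {}s _ _ /(congr1 size).
by rewrite size_rcons.
Qed.

Lemma filtration_rcons_inv X s N : filtration X (rcons s N) ->
  exists L (f : mor L X) (g : mor X N), short_exact f g /\ filtration L s.
Proof.
move E: (rcons s N) => t XF; case: XF E => [Y _ /(congr1 size)|].
  by rewrite size_rcons.
by move=> L M N' f g t' fg Lt /rcons_inj[-> ->]; exists L, f, g.
Qed.

Lemma filtration_isomorphic X Y s :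
  isomorphic X Y -> filtration X s -> filtration Y s.
Proof.
move=> XY; case/lastP: s => [|s N] XF.
  by constructor; apply: isomorphic_zero XY _; exact: filtration0_inv.
have [L [f [g [fg Ls]]]] := filtration_rcons_inv XF.
have [p [q [qp pq]]] := XY.
exact: FiltrationS (ses_iso_mid fg qp pq) Ls.
Qed.

Hypothesis hab : abelian A.

Lemma filtration_single X : filtration X [:: X].
Proof.
have [K [k [K0 kX]]] := zero_ses hab X.
exact: (FiltrationS (s := [::]) kX (Filtration0 K0)).
Qed.

(** One lifts the last step of the filtration of [N] to its preimage in [M]. *)
Lemma filtration_cat L M N (f : mor L M) (g : mor M N) s t :
  short_exact f g -> filtration L s -> filtration N t -> filtration M (s ++ t).
Proof.
move=> fg Ls; elim/last_ind: t => [|t N2 IH] in M N f g fg * => Nt.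
  rewrite cats0; apply: filtration_isomorphic Ls.
  by exists f; apply: ses_iso_sub fg _; exact: filtration0_inv.
have [N1 [i [q [iq N1t]]]] := filtration_rcons_inv Nt.
have [P [f' [e [j [f'e jqg _ _]]]]] := preimage_ses hab fg iq.
by rewrite -rcons_cat; apply: FiltrationS jqg _; exact: IH f'e N1t.
Qed.

Hypothesis hlen : length_category A.

(** If the two series end with distinct maximal subobjects [L] and [L'], both are
    compared with a series through the intersection of [L] and [L']. Indicators
    of isomorphism classes as weights give the usual statement on multiplicities;
    equality of the sizes is a separate clause because the induction, on the size
    of [s], needs it. *)
Lemma jordan_holder (V : nmodType) (w : A -> V) X s t :
  (forall Y Z, isomorphic Y Z -> w Y = w Z) ->
  filtration X s -> filtration X t ->
  Forall (@is_simple A) s -> Forall (@is_simple A) t ->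
  size s = size t /\ \sum_(F <- s) w F = \sum_(F <- t) w F.
Proof.
move=> wiso; have [n] := ubnP (size s).
elim: n => // n IH in X s t * => sn Xs Xt ss st.
case/lastP: s => [|s N] in sn Xs ss *; case/lastP: t => [|t N'] in Xt st *.
- by [].
- have [L [f [g [fg _]]]] := filtration_rcons_inv Xt.
  by have /Forall_rcons[_ []] := st; case: (ses_zero_mid fg (filtration0_inv Xs)).
- have [L [f [g [fg _]]]] := filtration_rcons_inv Xs.
  by have /Forall_rcons[_ []] := ss; case: (ses_zero_mid fg (filtration0_inv Xt)).
have [L [f [g [fg Ls]]]] := filtration_rcons_inv Xs.
have [L' [f' [g' [fg' Lt]]]] := filtration_rcons_inv Xt.
move: ss st => /Forall_rcons[ss sN] /Forall_rcons[st sN'].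
move: sn; rewrite size_rcons ltnS => sn.
rewrite !size_rcons -!cats1 !big_cat !big_seq1 /=.
have [g'f0|g'f] := EM (g' ** f = 0).
  (* [L] lies in [L'], both being maximal subobjects, so they coincide *)
  have [u ug] := cokernel_desc fg.2 g'f0.
  have u0 : u <> 0.
    move=> u0; case: sN' => + _; apply; apply/is_zeroP.
    by apply: (ses_epi fg'); rewrite -ug u0 !comp0m compm0.
  have um := simple_mono hab sN u0; have ue := simple_epi hab sN' u0.
  have [b fb] : exists b, f ** b = f'.
    by apply: (kernel_lift fg.1); apply: um; rewrite compA ug (ses_comp fg') compm0.
  have [a fa] := kernel_lift fg'.1 g'f0.
  have L'L : isomorphic L' L.
    exists b, a; split; first by apply: (ses_mono fg'); rewrite compA fa fb compm1.
    by apply: (ses_mono fg); rewrite compA fb fa compm1.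
  have NN' : isomorphic N N' by exists u; exact: mono_epi_iso.
  have [-> ->] := IH _ _ _ sn Ls (filtration_isomorphic L'L Lt) ss st.
  by rewrite (wiso _ _ NN').
have gf' : g ** f' <> 0.
  move=> gf'0; have [u ug] := cokernel_desc fg'.2 gf'0.
  have um : is_mono u.
    apply: simple_mono => // u0; case: sN => + _; apply; apply/is_zeroP.
    by apply: (ses_epi fg); rewrite -ug u0 !comp0m compm0.
  by apply: g'f; apply: um; rewrite compA ug (ses_comp fg) compm0.
have [K [k [k' [kL kL']]]] := kernels_cap hab fg fg'
  (simple_epi hab sN' g'f) (simple_epi hab sN gf').
have [r [Kr sr]] := hlen K.
have LrN' := FiltrationS kL Kr; have LrN := FiltrationS kL' Kr.
have srN' : Forall (@is_simple A) (rcons r N') by exact/Forall_rcons.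
have srN : Forall (@is_simple A) (rcons r N) by exact/Forall_rcons.
have [size_s sum_s] := IH _ _ _ sn Ls LrN' ss srN'.
have [|size_t sum_t] := IH _ _ _ _ LrN Lt srN st.
  by move: sn; rewrite size_s !size_rcons.
move: size_s size_t sum_s sum_t; rewrite !size_rcons => -> <-.
by rewrite -!cats1 !big_cat !big_seq1 /= => -> <-; rewrite addrAC.
Qed.

Definition composition_series X : seq A := sval (cid (hlen X)).

Lemma composition_seriesP X :
  filtration X (composition_series X) /\
  Forall (@is_simple A) (composition_series X).
Proof. exact: (svalP (cid (hlen X))). Qed.

Definition len X : nat := size (composition_series X).

Definition mult B X : nat :=
  \sum_(F <- composition_series X) (`[< isomorphic F B >] : nat).

Lemma sum_composition_series (V : nmodType) (w : A -> V) X s :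
  (forall Y Z, isomorphic Y Z -> w Y = w Z) ->
  filtration X s -> Forall (@is_simple A) s ->
  len X = size s /\ \sum_(F <- composition_series X) w F = \sum_(F <- s) w F.
Proof.
move=> wiso Xs ss; have [Xc sc] := composition_seriesP X.
exact: jordan_holder wiso Xc Xs sc ss.
Qed.

Lemma composition_series_exact (V : nmodType) (w : A -> V) L M N
    (f : mor L M) (g : mor M N) :
  (forall Y Z, isomorphic Y Z -> w Y = w Z) -> short_exact f g ->
  len M = (len L + len N)%N /\
  \sum_(F <- composition_series M) w F =
  \sum_(F <- composition_series L) w F + \sum_(F <- composition_series N) w F.
Proof.
move=> wiso fg; have [Lc sL] := composition_seriesP L.
have [Nc sN] := composition_seriesP N.
have Mc := filtration_cat fg Lc Nc.
have sM : Forall (@is_simple A) (composition_series L ++ composition_series N).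
  exact/Forall_cat.
have [-> ->] := sum_composition_series wiso Mc sM.
by rewrite size_cat big_cat.
Qed.

Lemma len_exact L M N (f : mor L M) (g : mor M N) :
  short_exact f g -> len M = (len L + len N)%N.
Proof. by move=> /(composition_series_exact (w := fun=> 0%N))[]. Qed.

Lemma isomorphic_asbool B Y Z :
  isomorphic Y Z -> `[< isomorphic Y B >] = `[< isomorphic Z B >].
Proof.
move=> YZ; apply/asbool_equiv_eq; split; apply: isomorphic_trans => //.
exact: isomorphic_sym.
Qed.

Lemma mult_exact B L M N (f : mor L M) (g : mor M N) :
  short_exact f g -> mult B M = (mult B L + mult B N)%N.
Proof.
move=> fg; have wiso Y Z : isomorphic Y Z ->
    (`[< isomorphic Y B >] : nat) = `[< isomorphic Z B >].
  by move=> /isomorphic_asbool ->.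
exact: (composition_series_exact wiso fg).2.
Qed.

Lemma len_gt0 X : ~ is_zero X -> (0 < len X)%N.
Proof.
move=> X0; rewrite /len; have [] := composition_seriesP X.
by case: (composition_series X) => //= /filtration0_inv.
Qed.

Lemma mult_simple B X : is_simple X -> mult B X = `[< isomorphic X B >].
Proof.
move=> Xs; have wiso Y Z : isomorphic Y Z ->
    (`[< isomorphic Y B >] : nat) = `[< isomorphic Z B >].
  by move=> /isomorphic_asbool ->.
have sX : Forall (@is_simple A) [:: X] by constructor=> //; constructor.
rewrite [LHS](sum_composition_series wiso (filtration_single X) sX).2.
by rewrite big_seq1.
Qed.

Lemma ses_len_sub L M N (f : mor L M) (g : mor M N) :
  short_exact f g -> ~ is_zero N -> (len L < len M)%N.
Proof. by move=> /len_exact -> /len_gt0; lia. Qed.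

Lemma ses_len_quot L M N (f : mor L M) (g : mor M N) :
  short_exact f g -> ~ is_zero L -> (len N < len M)%N.
Proof. by move=> /len_exact -> /len_gt0; lia. Qed.

End Filtrations.

(** * The Grothendieck group and dimension vectors *)

Section AdditiveFunctions.
Variables (A : preadditive) (V : zmodType).
Implicit Types X Y Z L M N : A.

Definition additive_function (w : A -> V) :=
  forall L M N (f : mor L M) (g : mor M N), short_exact f g -> w M = w L + w N.

Variable w : A -> V.
Hypothesis wD : additive_function w.

Lemma additive_function0 Z : is_zero Z -> w Z = 0.
Proof.
move=> Z0; have ZZ : short_exact (idm Z) (idm Z).
  split.
    apply: mono_is_kernel; [exact: idm_mono|exact: to_zero|].
    by move=> W h _; exists h; rewrite comp1m.
  apply: epi_is_cokernel; [exact: idm_epi|exact: to_zero|].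
  by move=> W h _; exists h; rewrite compm1.
by apply: (addrI (w Z)); rewrite addr0 -(wD ZZ).
Qed.

Lemma additive_function_iso X Y : abelian A -> isomorphic X Y -> w X = w Y.
Proof.
move=> hab [f fiso]; have [K [k kf]] := epi_ses hab (iso_epi fiso).
rewrite (wD kf) additive_function0 ?add0r //.
apply/is_zeroP; apply: (ses_mono kf); apply: (iso_mono fiso).
by rewrite compm1 (ses_comp kf) !compm0.
Qed.

End AdditiveFunctions.

Section GrothendieckGroup.
Variable A : preadditive.
Implicit Types X Y L M N : A.

Definition K0_of (x : {freeg {classic A} / int}) : K0 A :=
  \pi_(Quotient.quot (@K0_ideal A))%qT x.

Lemma K0_ofB x y : K0_of (x - y) = K0_of x - K0_of y.
Proof.
apply: etrans (Quotient.pi_add (@K0_ideal A) x (- y)) _.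
congr Quotient.add; exact: Quotient.pi_opp.
Qed.

Lemma K0_of_eq x y : (K0_of x == K0_of y) = `[< K0_relation (x - y) >].
Proof. by rewrite -[RHS]/(x - y \in @K0_ideal A) Quotient.idealrBE. Qed.

Lemma K0class_additive : additive_function (@K0class A).
Proof.
move=> L M N f g fg; apply/eqP; rewrite addrC -subr_eq.
rewrite -[K0class M - _]K0_ofB K0_of_eq; apply/asboolP.
exact: K0rel_exact fg.
Qed.

Lemma K0_lift (V : zmodType) (w : A -> V) :
  additive_function w ->
  exists h : {additive K0 A -> V}, forall X, h (K0class X) = w X.
Proof.
move=> wD; pose lw := fglift (M := zmodule V) (w : {classic A} -> zmodule V).
have lwB x y : lw (x - y) = lw x - lw y by exact: lift_is_additive.
have lwX X : lw (fobj X) = w X by rewrite /lw liftU scale1r.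
have lw0 x : K0_relation x -> lw x = 0.
  elim=> {x}[|x y _ x0 _ y0|L M N f g fg].
  - by have := lwB 0 0; rewrite !subrr.
  - by rewrite lwB x0 y0 subrr.
  - by rewrite !lwB !lwX (wD _ _ _ _ _ fg) addrAC addrK subrr.
have lw_repr (x : K0 A) (y : {freeg {classic A} / int}) : K0_of y = x ->
    lw (repr x) = lw y.
  move=> yx; apply/eqP; rewrite -subr_eq0 -lwB; apply/eqP/lw0/asboolP.
  by rewrite -K0_of_eq yx /K0_of reprK.
pose h (x : K0 A) : V := lw (repr x).
have hB : zmod_morphism h.
  move=> x y; rewrite /h -[RHS]lwB; apply: lw_repr.
  by rewrite K0_ofB /K0_of !reprK.
pose hadd := GRing.isZmodMorphism.Build _ _ h hB.
pose H : {additive K0 A -> V} := HB.pack h hadd.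
exists H => X; rewrite -[LHS]/(h (K0class X)).
by rewrite /h (lw_repr _ (fobj X)).
Qed.

End GrothendieckGroup.

Section DimensionVectors.
Variables (A : preadditive) (n : nat) (S : 'I_n -> A).
Hypotheses (hab : abelian A) (hlen : length_category A).
Hypothesis hS : enumerates_simples S.
Implicit Types X Y L M N : A.

Lemma mult_additive B : additive_function (fun X => (mult hlen B X)%:Z).
Proof. by move=> L M N f g fg; rewrite (mult_exact hab hlen B fg) PoszD. Qed.

Lemma K0class_simples X :
  K0class X = \sum_(i < n) K0class (S i) *~ (mult hlen (S i) X)%:Z.
Proof.
pose v Y := \sum_(i < n) K0class (S i) *~ (mult hlen (S i) Y)%:Z.
have vD : additive_function v.
  move=> L M N f g fg; rewrite /v -big_split; apply: eq_bigr => i _ /=.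
  by rewrite (mult_additive _ fg) mulrzDr.
have [_ S_inj S_surj] := hS.
have v_simple F : is_simple F -> v F = K0class F.
  move=> Fs; have [i Fi] := S_surj F Fs.
  rewrite /v (bigD1 i) //= (mult_simple hab hlen) // asboolT // mulr1z.
  rewrite big1 ?addr0 => [|j j_neq_i].
    exact/esym/(additive_function_iso (@K0class_additive A) hab Fi).
  rewrite (mult_simple hab hlen) // asboolF ?mulr0z // => Fj.
  case/negP: j_neq_i; apply/eqP/S_inj.
  exact: isomorphic_trans (isomorphic_sym Fj) Fi.
rewrite -/(v X); have [Xs ss] := composition_seriesP hlen X.
move: (composition_series hlen X) Xs ss => s.
elim/last_ind: s X => [|s N IH] X Xs ss.
  have X0 := filtration0_inv Xs.
  by rewrite (additive_function0 (@K0class_additive A)) ?(additive_function0 vD).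
have [L [f [g [fg Ls]]]] := filtration_rcons_inv Xs.
have /Forall_rcons[sL sN] := ss.
by rewrite (K0class_additive fg) (vD _ _ _ _ _ fg) (v_simple N) // IH.
Qed.

(** The coordinates of a class in [K0] are the Jordan-Hölder multiplicities,
    these being additive functions dual to the simple objects. *)
Lemma dimvecE X i : dimvec S X 0 i = (mult hlen (S i) X)%:Z.
Proof.
have [S_simple S_inj _] := hS.
rewrite /dimvec.
case: xgetP => [v _ /= vX|/(_ (\row_j (mult hlen (S j) X)%:Z)) []]; last first.
  by rewrite /= [LHS]K0class_simples; apply: eq_bigr => j _; rewrite mxE.
have [h hX] := K0_lift (mult_additive (S i)).
rewrite -hX vX raddf_sum (bigD1 i) //= raddfMz hX (mult_simple hab hlen) //.
rewrite asboolT ?mulrzz ?mul1r; last exact: isomorphic_refl.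
rewrite big1 ?addr0 // => j j_neq_i.
rewrite raddfMz hX (mult_simple hab hlen) // asboolF ?mul0rz // => ji.
by case/negP: j_neq_i; apply/eqP/S_inj.
Qed.

Lemma exists_mult_gt0 X : ~ is_zero X -> exists i, (0 < mult hlen (S i) X)%N.
Proof.
move=> X0; have [Xs ss] := composition_seriesP hlen X.
case/lastP: (composition_series hlen X) => [|s N] in Xs ss *.
  by case: X0; exact: filtration0_inv.
have [L [f [g [fg _]]]] := filtration_rcons_inv Xs.
have /Forall_rcons[_ sN] := ss; have [_ _ /(_ N sN)[i Ni]] := hS.
exists i; rewrite (mult_exact hab hlen _ fg) (mult_simple hab hlen _ sN).
by rewrite asboolT // addn1.
Qed.

Section Pairing.
Variable R : realType.
Implicit Types theta beta : 'rV[R]_n.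

Lemma pairing_additive theta : additive_function (pairing S theta).
Proof.
move=> L M N f g fg; rewrite /pairing -big_split; apply: eq_bigr => i _ /=.
by rewrite !dimvecE (mult_additive _ fg) intrD mulrDr.
Qed.

Lemma pairing_gt0 beta X :
  positive_vector beta -> ~ is_zero X -> 0 < pairing S beta X.
Proof.
move=> beta_gt0 /exists_mult_gt0[i Xi]; rewrite /pairing (bigD1 i) //=.
rewrite ltr_pwDl ?sumr_ge0 // => [|j _]; rewrite dimvecE ?pmulr_rgt0 ?ltr0n //.
by rewrite mulr_ge0 ?ler0n // ltW.
Qed.

End Pairing.

End DimensionVectors.

(** * Torsion pairs *)

Section TorsionClasses.
Variable A : preadditive.
Hypotheses (hab : abelian A) (hlen : length_category A).
Implicit Types (X Y L M N Q W : A) (T U : set A).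
Local Notation len := (len hlen).

Definition torsion_free T W := forall Y (f : mor Y W), T Y -> f = 0.

(** The torsion pair of a torsion class: while [X] is not torsion-free, the
    image of a nonzero map from [T] to [X] is a torsion subobject by which one
    can divide, decreasing the length. *)
Lemma torsion_decomposition T X : torsion_class T ->
  (forall Z, is_zero Z -> T Z) ->
  exists L Q (l : mor L X) (q : mor X Q),
    [/\ short_exact l q, T L & torsion_free T Q].
Proof.
move=> Tt T0; have [n] := ubnP (len X); elim: n => // n IH in X * => Xn.
have [Xfree|/existsNP[Y /existsNP[f /not_implyP[TY f0]]]] := EM (torsion_free T X).
  have [K [k [K0 kX]]] := zero_ses hab X; exists K, X, k, (idm X).
  by split=> //; exact: T0.
have [I [e [i [ee im fE]]]] := image_factorization hab f.
have [C [c ic]] := mono_ses hab im.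
have I_neq0 : ~ is_zero I.
  by move=> I0; apply: f0; rewrite fE (from_zero i I0) comp0m.
have [|L [Q [l [q [lq TL Qfree]]]]] := IH C.
  by have := ses_len_quot hab hlen ic I_neq0; lia.
have [P [l' [e' [j [l'e' jqc _ _]]]]] := preimage_ses hab ic lq.
exists P, Q, j, (q ** c); split=> //.
by apply: (torsion_ext Tt l'e') => //; exact: torsion_factor ee TY.
Qed.

Lemma filtration_torsion T X s : torsion_class T ->
  (forall Z, is_zero Z -> T Z) ->
  filtration X s -> Forall T s -> T X.
Proof.
move=> Tt T0; elim=> [Y Y0 _|L M N f g t fg _ IH /Forall_rcons[Lt TN]].
  exact: T0.
by apply: (torsion_ext Tt fg) => //; exact: IH.
Qed.

Lemma Forall_impl (B : Type) (P Q : B -> Prop) (s : seq B) :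
  (forall x, P x -> Q x) -> Forall P s -> Forall Q s.
Proof. by move=> PQ; elim=> [|x t /PQ Qx _ Qt]; constructor. Qed.

Lemma Filt_ext (C : set A) L M N (f : mor L M) (g : mor M N) :
  short_exact f g -> Filt C L -> Filt C N -> Filt C M.
Proof.
move=> fg [s [Ls sC]] [t [Nt tC]]; exists (s ++ t); split.
  exact: (filtration_cat hab fg).
exact/Forall_cat.
Qed.

Lemma Filt_indecomposable (C : set A) X : C X -> indecomposable X -> Filt C X.
Proof.
move=> CX Xi; exists [:: X]; split; first exact: filtration_single.
by constructor; [exists X; split=> //; exact: isomorphic_refl|constructor].
Qed.

Lemma subset_Filt (C D : set A) : C `<=` D -> Filt C `<=` Filt D.
Proof.
move=> CD X [s [Xs sC]]; exists s; split=> //.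
by apply: Forall_impl sC => F [G [/CD DG Gi FG]]; exists G.
Qed.

(** The definition of [Filt] only admits indecomposable factors, so an object of
    [T] is first split into indecomposable summands, which are factors of it. *)
Lemma torsion_sub_Filt T : torsion_class T -> T `<=` Filt T.
Proof.
move=> Tt X; have [n] := ubnP (len X); elim: n => // n IH in X * => Xn TX.
have [X0|X_neq0] := EM (is_zero X).
  by exists [::]; split; [exact: Filtration0|constructor].
have [Xi|Xni] := EM (indecomposable X); first exact: Filt_indecomposable.
have /existsNP[Y /existsNP[Z /not_implyP[XYZ /not_orP[Y0 Z0]]]] :
    ~ (forall Y Z, is_biproduct Y Z X -> is_zero Y \/ is_zero Z).
  by move=> H; apply: Xni.
have [i [p ip]] := biproduct_ses XYZ.
have [i' [p' ip']] := biproduct_ses (biproduct_sym XYZ).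
apply: (Filt_ext ip); apply: IH.
- by have := ses_len_sub hab hlen ip Z0; lia.
- exact: (torsion_factor Tt (ses_epi ip')).
- by have := ses_len_quot hab hlen ip Y0; lia.
- exact: (torsion_factor Tt (ses_epi ip)).
Qed.

Lemma Filt_nonzero_map (C : set A) X : Filt C X -> ~ is_zero X ->
  exists G (f : mor G X), C G /\ f <> 0.
Proof.
move=> [s [+ +]]; elim=> [//|L M N f g t fg _ IH /Forall_rcons[tC NC]] M0.
have [L0|/(IH tC)[G [h [CG h0]]]] := EM (is_zero L).
  have [g' [g'g gg']] := ses_iso_quot fg L0.
  have [G [CG _ [p [p' [p'p pp']]]]] := NC.
  exists G, (g' ** p'); split=> // g'p'0; apply: M0; apply/is_zeroP.
  by rewrite -g'g -[g]comp1m -p'p !compA g'p'0 !comp0m.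
exists G, (f ** h); split=> // fh0; apply: h0.
by apply: (ses_mono fg); rewrite compm0.
Qed.

(** The image of [f] is torsion-free, so it is no proper factor of [N]. *)
Lemma proper_factors_mono T N W (f : mor N W) :
  (forall Q (q : mor N Q), is_epi q -> ~ is_iso q -> T Q) ->
  torsion_free T W -> f <> 0 -> is_mono f.
Proof.
move=> Nfac Wfree f0; have [I [e [i [ee im fE]]]] := image_factorization hab f.
have [ei|/(Nfac _ _ ee) TI] := EM (is_iso e).
  by rewrite fE; apply: mono_comp => //; exact: iso_mono.
by case: f0; rewrite fE (Wfree _ i TI) comp0m.
Qed.

(** Such an [X] is an iterated extension of copies of [N]; what is used of this
    is that its class is a multiple of that of [N]. As long as [X] is nonzero it
    has a subobject [N], and [X / N] is torsion-free again: let [P] be the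
    preimage in [X] of a torsion subobject [L] of [X / N]. If [P], an extension
    of [L] by [N], is split, then [L] embeds into [X] and is zero; if not, then
    [P] is a torsion subobject of [X], hence zero, which [N] is not. *)
Lemma minimal_extending_free T N X : torsion_class T ->
  (forall Z, is_zero Z -> T Z) -> minimal_extending T N ->
  torsion_class (Filt (T `|` [set N])) ->
  Filt (T `|` [set N]) X -> torsion_free T X ->
  exists k, forall (V : zmodType) (w : A -> V), additive_function w ->
    w X = w N *+ k.
Proof.
move=> Tt T0 [Nfac Next Nfree] T't.
have [n] := ubnP (len X); elim: n => // n IH in X * => Xn T'X Xfree.
have [X0|X_neq0] := EM (is_zero X).
  by exists 0%N => V w wD; rewrite (additive_function0 wD).
have [G [f [CG f0]]] := Filt_nonzero_map T'X X_neq0.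
case: CG => [TG|/= GN]; first by case: f0; exact: Xfree.
move: f f0; rewrite {}GN => f f0.
have N_neq0 : ~ is_zero N by move=> N0; apply: f0; exact: from_zero.
have [C [c fc]] := mono_ses hab (proper_factors_mono Nfac Xfree f0).
have [L [Q [l [q [lq TL Qfree]]]]] := torsion_decomposition C Tt T0.
have [P [f' [e [j [f'e jqc _ _]]]]] := preimage_ses hab fc lq.
have L0 : is_zero L.
  have [[_ [s es]]|fe_nsplit] := EM (split_exact f' e).
    apply/is_zeroP; rewrite -es.
    suff -> : s = 0 by rewrite compm0.
    by apply: (ses_mono jqc); rewrite compm0; exact: Xfree.
  have TP : T P by exact: Next TL f'e fe_nsplit.
  case: N_neq0; apply: mono_to_zero (ses_mono f'e) _.
  by apply/is_zeroP/(ses_mono jqc); rewrite compm0 compm1; exact: Xfree.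
have Cfree : torsion_free T C.
  move=> Y g TY; apply: (iso_mono (ses_iso_quot lq L0)).
  by rewrite compm0; exact: Qfree.
have [||k kC] := IH C _ _ Cfree.
- by have := ses_len_quot hab hlen fc N_neq0; lia.
- exact: torsion_factor (ses_epi fc) T'X.
by exists k.+1 => V w wD; rewrite (wD _ _ _ _ _ fc) (kC _ _ wD) mulrS.
Qed.

(** * Covers of torsion classes *)

Section Cover.
Variables T T' : set A.
Hypothesis TT' : torsion_cover T T'.
Hypothesis T0 : forall Z, is_zero Z -> T Z.

Let Tt : torsion_class T. Proof. by case: TT'. Qed.
Let T't : torsion_class T'. Proof. by case: TT'. Qed.
Let T_sub : T `<=` T'. Proof. by case: TT' => _ _ []. Qed.

(** As nothing lies strictly between [T] and [T'], the class [T] and the object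
    [Q] generate [T'], and the objects without nonzero maps to [W] form a torsion
    class. *)
Lemma cover_detect Q W : T' Q -> ~ T Q -> torsion_free T W ->
  (forall f : mor Q W, f = 0) -> forall X (f : mor X W), T' X -> f = 0.
Proof.
move=> T'Q nTQ Wfree QW X f T'X.
pose U := [set Y | T' Y /\ forall g : mor Y W, g = 0].
have Ut : torsion_class U.
  split=> [Y Z [p piso] [T'Y YW]|L M N l q lq [T'L LW] [T'N NW]|Y Z p pe [T'Y YW]].
  - have pe := iso_epi piso; split; first exact: torsion_factor pe T'Y.
    by move=> g; apply: pe; rewrite comp0m.
  - split; first exact: torsion_ext lq T'L T'N.
    move=> g; have [h <-] := cokernel_desc lq.2 (LW (g ** l)).
    by rewrite (NW h) comp0m.
  - split; first exact: torsion_factor pe T'Y.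
    by move=> g; apply: pe; rewrite comp0m.
have [_ _ _ Tmax] := TT'.
have [||UT|UT'] := Tmax U Ut.
- by move=> Y TY; split; [exact: T_sub|move=> g; exact: Wfree].
- by move=> Y [].
- by case: nTQ; rewrite -UT; split.
- by have [_] : U X by rewrite UT'.
Qed.

Section MinimalObject.
Variable N : A.
Hypotheses (T'N : T' N) (nTN : ~ T N).
Hypothesis Nmin : forall X, T' X -> ~ T X -> (len N <= len X)%N.

Let N_neq0 : ~ is_zero N. Proof. by move=> /T0. Qed.

Lemma minimal_proper_factor Q (q : mor N Q) : is_epi q -> ~ is_iso q -> T Q.
Proof.
move=> qe niso; apply: contrapT => nTQ.
have [K [k kq]] := epi_ses hab qe.
have [K0|K_neq0] := EM (is_zero K); first exact/niso/(ses_iso_quot kq).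
have := ses_len_quot hab hlen kq K_neq0.
by have := Nmin (torsion_factor T't qe T'N) nTQ; lia.
Qed.

(** The image of a nonzero map from [T] to [N] would be in [T], together with
    the factor of [N] by it, and so would [N]. *)
Lemma minimal_torsion_free : torsion_free T N.
Proof.
move=> Y f TY; apply: contrapT => f0.
have [I [e [i [ee im fE]]]] := image_factorization hab f.
have TI := torsion_factor Tt ee TY.
have i0 : i <> 0 by move=> i0; apply: f0; rewrite fE i0 comp0m.
have [C [c ic]] := mono_ses hab im.
apply: nTN; apply: (torsion_ext Tt ic TI).
apply: minimal_proper_factor (ses_epi ic) _ => /iso_mono cm.
by apply: i0; apply: cm; rewrite compm0 (ses_comp ic).
Qed.

Lemma minimal_sub I (i : mor I N) : is_mono i -> T' I -> i <> 0 -> is_iso i.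
Proof.
move=> im T'I i0; have [TI|nTI] := EM (T I).
  by case: i0; exact: minimal_torsion_free.
have [C [c ic]] := mono_ses hab im.
apply: (ses_iso_sub ic); apply: contrapT => C0.
by have := ses_len_sub hab hlen ic C0; have := Nmin T'I nTI; lia.
Qed.

Lemma minimal_brick : brick N.
Proof.
split=> [/is_zeroP //|f f0].
have [I [e [i [ee im fE]]]] := image_factorization hab f.
have fe : is_epi f.
  rewrite fE; apply: epi_comp => //; apply: iso_epi.
  apply: minimal_sub => //; first exact: torsion_factor ee T'N.
  by move=> i0; apply: f0; rewrite fE i0 comp0m.
by apply: contrapT => /(minimal_proper_factor fe).
Qed.

(** In an extension [X] of [Y] by [N] outside [T], the torsion-free quotient [Q]
    of [X] is again an extension of an object of [T] by [N], and it is outside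
    [T]. By [cover_detect] there is a nonzero map [h] from [Q] to [N]. It is
    nonzero on [N], as an object of [T] has no nonzero map to [N]; so, [N] being
    a brick, it is invertible there and splits the extension. *)
Lemma minimal_minimal_extending : minimal_extending T N.
Proof.
split; [exact: minimal_proper_factor| |exact: minimal_torsion_free].
move=> X Y f g TY fg nsplit; apply: contrapT => nTX.
have T'X : T' X by apply: (torsion_ext T't fg) => //; exact: T_sub.
have [L [Q [l [q [lq TL Qfree]]]]] := torsion_decomposition X Tt T0.
have nTQ : ~ T Q by move=> TQ; apply: nTX; exact: torsion_ext lq TL TQ.
have T'Q : T' Q by exact: torsion_factor (ses_epi lq) T'X.
have qf0 : q ** f <> 0.
  move=> /(cokernel_desc fg.2)[u uq]; apply: nTQ; apply: T0.
  apply/is_zeroP; apply: (ses_epi lq).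
  by rewrite -uq (Qfree _ u TY) !(comp0m, compm0).
have qfm := proper_factors_mono minimal_proper_factor Qfree qf0.
have [C [c qfc]] := mono_ses hab qfm.
have TC : T C.
  have [|v vg] := cokernel_desc fg.2 (h := c ** q).
    by rewrite -compA (ses_comp qfc).
  apply: (torsion_factor Tt (f := v)) => //.
  apply: (@epi_cancel _ _ _ _ _ g); rewrite vg.
  exact: epi_comp (ses_epi qfc) (ses_epi lq).
have [h h0] : exists h : mor Q N, h <> 0.
  apply: contrapT => QN; apply: N_neq0; apply/is_zeroP.
  apply: (cover_detect T'Q nTQ minimal_torsion_free) => // h.
  by apply: contrapT => h0; apply: QN; exists h.
have hqf0 : h ** (q ** f) <> 0.
  move=> /(cokernel_desc qfc.2)[u uc]; apply: h0.
  by rewrite -uc (minimal_torsion_free u TC) comp0m.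
have [r [rhqf _]] := minimal_brick.2 _ hqf0.
(* [r ** h ** q] is a retraction of [f] *)
have [|s sg] := cokernel_desc fg.2 (h := idm X - f ** (r ** h ** q)).
  by rewrite compBl comp1m -!compA rhqf compm1 subrr.
apply: nsplit; split=> //; exists s; apply: (ses_epi fg).
by rewrite -compA sg compBr compm1 compA (ses_comp fg) comp0m subr0 comp1m.
Qed.

(** The torsion-free quotient of an object [X] of [T'] outside [T] contains a
    copy of [N] by [cover_detect]. The preimage of this copy in [X] is an
    extension of [N] by an object of [T], and one goes on with the factor of [X]
    by it. *)
Lemma minimal_Filt : T' = Filt (T `|` [set N]).
Proof.
have FN : Filt (T `|` [set N]) N.
  apply: Filt_indecomposable; first by right.
  exact: brick_indecomposable minimal_brick.
apply/seteqP; split=> [X|X [s [Xs sTN]]]; last first.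
  apply: (filtration_torsion T't _ Xs) => [Z /T0 /T_sub //|].
  apply: Forall_impl sTN => F [G [TNG _ FG]].
  apply: (torsion_iso T't (isomorphic_sym FG)).
  by case: TNG => [/T_sub //|-> //].
have [n] := ubnP (len X); elim: n => // n IH in X * => Xn T'X.
have [TX|nTX] := EM (T X).
  by apply: (@subset_Filt T); [move=> Y; left|exact: torsion_sub_Filt].
have [L [Q [l [q [lq TL Qfree]]]]] := torsion_decomposition X Tt T0.
have nTQ : ~ T Q by move=> TQ; apply: nTX; exact: torsion_ext lq TL TQ.
have T'Q : T' Q by exact: torsion_factor (ses_epi lq) T'X.
have [f f0] : exists f : mor N Q, f <> 0.
  apply: contrapT => NQ; apply: nTQ; apply: T0; apply/is_zeroP.
  apply: (cover_detect T'N nTN Qfree) => // f.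
  by apply: contrapT => f0; apply: NQ; exists f.
have fm := proper_factors_mono minimal_proper_factor Qfree f0.
have [C [c fc]] := mono_ses hab fm.
have [P [l' [e [j [l'e jcq _ _]]]]] := preimage_ses hab lq fc.
have FP : Filt (T `|` [set N]) P.
  apply: (Filt_ext l'e) => //; apply: (@subset_Filt T); first by move=> Y; left.
  exact: torsion_sub_Filt.
apply: (Filt_ext jcq) => //; apply: IH; last exact: torsion_factor (ses_epi fc) T'Q.
have P0 : ~ is_zero P by move=> /(ses_zero_mid l'e)[].
by have := ses_len_quot hab hlen jcq P0; lia.
Qed.

End MinimalObject.

Lemma cover_minimal_extending : exists N,
  [/\ brick N, minimal_extending T N & T' = Filt (T `|` [set N])].
Proof.
have [X [T'X nTX]] : exists X, T' X /\ ~ T X.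
  have [_ _ [_ nT'T] _] := TT'; apply: contrapT => noX; apply: nT'T => X T'X.
  by apply: contrapT => nTX; apply: noX; exists X.
have exN : exists k, `[< exists N, [/\ T' N, ~ T N & len N = k] >].
  by exists (len X); apply/asboolP; exists X.
case: (ex_minnP exN) => _ /asboolP[N [T'N nTN <-]] Nmin.
have {}Nmin Y : T' Y -> ~ T Y -> (len N <= len Y)%N.
  by move=> T'Y nTY; apply: Nmin; apply/asboolP; exists Y.
exists N; split; first exact: minimal_brick.
  exact: minimal_minimal_extending.
exact: minimal_Filt.
Qed.

End Cover.

End TorsionClasses.

(** * Comparison of arguments in the upper half-plane *)

Section Argument.
Variable R : realType.
Implicit Types x y : R.

(** Put [r = |x + i y|] and [r' = |x' + i y'|]. The numbers [x' * r] and
    [x * r'] have the signs of [x' * y] and [x * y'], and both pairs have the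
    same difference of squares. *)
Lemma slope_cos_lt x y x' y' r r' :
  0 < y -> 0 < y' -> 0 < r -> 0 < r' ->
  r ^+ 2 = x ^+ 2 + y ^+ 2 -> r' ^+ 2 = x' ^+ 2 + y' ^+ 2 ->
  x' * y < x * y' -> x' * r < x * r'.
Proof.
move: x y x' y' r r'.
have nneg_case x y x' y' r r' : 0 <= x' ->
    0 < y -> 0 < y' -> 0 < r -> 0 < r' ->
    r ^+ 2 = x ^+ 2 + y ^+ 2 -> r' ^+ 2 = x' ^+ 2 + y' ^+ 2 ->
    x' * y < x * y' -> x' * r < x * r'.
  move=> x'0 y0 y'0 r0 r'0 rE r'E xy.
  have x0 : 0 < x.
    by rewrite -(pmulr_lgt0 _ y'0) (le_lt_trans _ xy) ?mulr_ge0 // ltW.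
  have xx'y : (x' * y) ^+ 2 < (x * y') ^+ 2.
    by rewrite ltr_sqr ?nnegrE ?mulr_ge0 ?(ltW x0) ?(ltW y0) ?(ltW y'0).
  rewrite -ltr_sqr ?nnegrE ?mulr_ge0 ?(ltW x0) ?(ltW r0) ?(ltW r'0) //.
  by move: xx'y; rewrite !exprMn rE r'E !mulrDr [x' ^+ 2 * x ^+ 2]mulrC ltrD2l.
move=> x y x' y' r r' y0 y'0 r0 r'0 rE r'E xy.
have [x'0|x'0] := leP 0 x'; first exact: nneg_case xy.
have [x0|x0] := leP 0 x.
  by rewrite (@lt_le_trans _ _ 0) ?nmulr_rlt0 ?mulr_ge0 // ltW.
rewrite -ltrN2 -!mulNr; apply: (nneg_case _ _ _ _ _ _ _ y'0 y0 r'0 r0).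
- by rewrite oppr_ge0 ltW.
- by rewrite sqrrN.
- by rewrite sqrrN.
- by rewrite !mulNr ltrN2.
Qed.

(** By equality of the squares the two sides agree up to sign; if they are
    opposite, then so are the signs of [x] and [x'], which are also equal. *)
Lemma slope_cos_eq x y x' y' r r' :
  0 < y -> 0 < y' -> 0 < r -> 0 < r' ->
  r ^+ 2 = x ^+ 2 + y ^+ 2 -> r' ^+ 2 = x' ^+ 2 + y' ^+ 2 ->
  x' * y = x * y' -> x' * r = x * r'.
Proof.
move=> y0 y'0 r0 r'0 rE r'E xy.
have /eqP : (x' * r) ^+ 2 = (x * r') ^+ 2.
  by rewrite !exprMn rE r'E !mulrDr -!exprMn xy [x' * x]mulrC.
rewrite eqf_sqr => /orP[/eqP //|/eqP xr].
have xx' : x * x' = 0.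
  apply/eqP; rewrite eq_le -(pmulr_lle0 _ r0) -mulrA xr mulrN oppr_le0 mulrA.
  rewrite mulr_ge0 ?(ltW r'0) -?expr2 ?sqr_ge0 //= -(pmulr_lge0 _ y0).
  by rewrite -mulrA xy mulrA mulr_ge0 ?(ltW y'0) // -expr2 sqr_ge0.
move/eqP: xx'; rewrite mulf_eq0 => /orP[] /eqP x0; move: xr; rewrite x0 !mul0r.
  by rewrite oppr0.
by move/eqP; rewrite eq_sym oppr_eq0 => /eqP ->.
Qed.

Let modulus x y := Num.sqrt (x ^+ 2 + y ^+ 2).

Lemma modulus_gt0 x y : 0 < y -> 0 < modulus x y.
Proof.
by move=> y0; rewrite sqrtr_gt0 ltr_wpDl ?sqr_ge0 // exprn_gt0.
Qed.

Lemma modulus_sqr x y : modulus x y ^+ 2 = x ^+ 2 + y ^+ 2.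
Proof. by rewrite sqr_sqrtr // addr_ge0 ?sqr_ge0. Qed.

Lemma cosine_bound x y : 0 < y -> -1 < x / modulus x y < 1.
Proof.
move=> y0; have r0 := modulus_gt0 x y0; rewrite -ltr_norml normrM normfV.
rewrite (gtr0_norm r0) ltr_pdivrMr // mul1r -ltr_sqr ?nnegrE // ?ltW //.
by rewrite modulus_sqr real_normK ?num_real // ltrDl exprn_gt0.
Qed.

Lemma argE x y : 0 < y -> arg (x +i* y)%C = acos (x / modulus x y).
Proof. by move=> y0; rewrite /arg /= ltW. Qed.

Lemma arg_ge0 x y : 0 < y -> 0 <= arg (x +i* y)%C.
Proof.
move=> y0; have /andP[? ?] := cosine_bound x y0.
by rewrite argE // acos_ge0 // !ltW.
Qed.

Lemma arg_lt_pi x y : 0 < y -> arg (x +i* y)%C < pi.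
Proof.
move=> y0; have /andP[? ?] := cosine_bound x y0; rewrite argE // acos_ltpi //.
by apply/andP; split=> //; exact: ltW.
Qed.

Lemma lt_arg x y x' y' : 0 < y -> 0 < y' ->
  (arg (x +i* y)%C < arg (x' +i* y')%C) = (x' * y < x * y').
Proof.
move=> y0 y'0; rewrite !argE //.
have /andP[u1 u2] := cosine_bound x y0.
have /andP[u'1 u'2] := cosine_bound x' y'0.
have r0 := modulus_gt0 x y0; have r'0 := modulus_gt0 x' y'0.
rewrite -ltr_cos ?in_itv /= ?acos_ge0 ?acos_lepi ?(ltW u1) ?(ltW u2) ?(ltW u'1)
  ?(ltW u'2) //.
rewrite !acosK ?in_itv /= ?(ltW u1) ?(ltW u2) ?(ltW u'1) ?(ltW u'2) //.
rewrite ltr_pdivrMr // mulrAC ltr_pdivlMr //.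
have rE := modulus_sqr x y; have r'E := modulus_sqr x' y'.
have [xy|xy|xy] := ltrgtP (x' * y) (x * y').
- exact: slope_cos_lt xy.
- by apply/negbTE; rewrite -leNgt ltW //; exact: slope_cos_lt xy.
by rewrite (slope_cos_eq y0 y'0 r0 r'0 rE r'E xy) ltxx.
Qed.

Lemma le_arg x y x' y' : 0 < y -> 0 < y' ->
  (arg (x +i* y)%C <= arg (x' +i* y')%C) = (x' * y <= x * y').
Proof. by move=> y0 y'0; rewrite !leNgt lt_arg. Qed.

End Argument.

(** * Stability by slopes *)

Lemma Forall_and (B : Type) (P Q : B -> Prop) (s : seq B) :
  Forall P s -> Forall Q s -> Forall (fun x => P x /\ Q x) s.
Proof.
elim=> [|x t Px _ IH] sQ; first by constructor.
by inversion_clear sQ; constructor=> //; exact: IH.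
Qed.

Lemma filtration_sub (A : preadditive) (X F : A) (s : seq A) :
  filtration X (F :: s) -> exists f : mor F X, is_mono f.
Proof.
elim/last_ind: s X => [|s N IH] X.
  move=> /(@filtration_rcons_inv _ _ [::])[L [f [g [fg /filtration0_inv L0]]]].
  have [g' [g'g gg']] := ses_iso_quot fg L0.
  by exists g'; apply: iso_mono; exists g.
rewrite -rcons_cons => /filtration_rcons_inv[L [f [g [fg /IH[h hm]]]]].
by exists (f ** h); exact: mono_comp (ses_mono fg) hm.
Qed.

(** The phase of a central charge enters only through [le_phi]: it orders
    objects by the slope [a / b], written without division so that additivity
    of [a] and [b] applies. *)
Section SlopeStability.
Variables (R : realType) (A : preadditive).
Hypotheses (hab : abelian A) (hlen : length_category A).
Variables (a b phi : A -> R).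
Hypotheses (aD : additive_function a) (bD : additive_function b).
Hypothesis le_phi : forall X Y : A, ~ is_zero X -> ~ is_zero Y ->
  (phi X <= phi Y) = (a Y * b X <= a X * b Y).
Implicit Types (X Y L M N F Q : A).

Lemma lt_phi X Y : ~ is_zero X -> ~ is_zero Y ->
  (phi X < phi Y) = (a Y * b X < a X * b Y).
Proof. by move=> X0 Y0; rewrite !ltNge le_phi. Qed.

Lemma eq_phi X Y : ~ is_zero X -> ~ is_zero Y ->
  (phi X == phi Y) = (a Y * b X == a X * b Y).
Proof. by move=> X0 Y0; rewrite !eq_le !le_phi. Qed.

Lemma phi_iso X Y : ~ is_zero X -> isomorphic X Y -> phi X = phi Y.
Proof.
move=> X0 XY; apply/eqP; rewrite eq_phi //; last exact: isomorphic_nonzero XY X0.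
by rewrite (additive_function_iso aD hab XY) (additive_function_iso bD hab XY).
Qed.

Lemma phi_seesaw L M N (f : mor L M) (g : mor M N) : short_exact f g ->
  ~ is_zero L -> ~ is_zero M -> ~ is_zero N ->
  [\/ phi L = phi M /\ phi M = phi N, phi L < phi M /\ phi M < phi N |
      phi L > phi M /\ phi M > phi N].
Proof.
move=> fg L0 M0 N0; have [LM|ML|LM] := ltrgtP (phi L) (phi M).
- apply: Or32; split=> //; move: LM; rewrite !lt_phi //.
  by rewrite (aD fg) (bD fg) => ?; lra.
- apply: Or33; split=> //; move: ML; rewrite !lt_phi //.
  by rewrite (aD fg) (bD fg) => ?; lra.
- apply: Or31; split=> //; apply/eqP; move/eqP: LM; rewrite !eq_phi //.
  by rewrite (aD fg) (bD fg) => /eqP ?; apply/eqP; lra.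
Qed.

Lemma slope_stability_function (D : set R) :
  (forall X, ~ is_zero X -> D (phi X)) -> stability_function D phi.
Proof. by move=> phiD; split=> //; [exact: phi_iso|exact: phi_seesaw]. Qed.

Lemma semistable_isomorphic X Y :
  isomorphic X Y -> semistable phi X -> semistable phi Y.
Proof.
move=> XY [X0 Xss]; have [p [q [qp pq]]] := XY.
split=> [|L f fm L0]; first exact: isomorphic_nonzero XY X0.
rewrite -(phi_iso X0 XY); apply: (Xss _ (q ** f)) => //.
by apply: mono_comp => //; apply: iso_mono; exists p.
Qed.

Lemma semistable_quotient F Q (q : mor F Q) :
  semistable phi F -> is_epi q -> ~ is_zero Q -> phi F <= phi Q.
Proof.
move=> [F0 Fss] qe Q0; have [L [l lq]] := epi_ses hab qe.
have [L0|L0] := EM (is_zero L).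
  by rewrite (phi_iso F0 (Y := Q)) //; exists q; exact: ses_iso_quot lq L0.
have := Fss L l (ses_mono lq) L0; rewrite !le_phi // (aD lq) (bD lq) => ?.
by lra.
Qed.

Lemma semistable_harder_narasimhan F :
  semistable phi F -> harder_narasimhan phi F [:: F].
Proof.
move=> Fss; split=> //; first exact: filtration_single.
by constructor=> //; constructor.
Qed.

Lemma harder_narasimhan_last_le X F s :
  harder_narasimhan phi X (rcons s F) ->
  Forall (fun G => phi F <= phi G) (rcons s F).
Proof.
move=> [_ _]; have tr : transitive (fun F G => phi F > phi G).
  by move=> Y Z W YZ YW; exact: lt_trans YW YZ.
elim: s => [_|G s IH /= Gs]; first by constructor=> //; constructor.
constructor; last exact/IH/(path_sorted Gs).
have := order_path_min tr Gs; rewrite all_rcons => /andP[FG _].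
exact: ltW.
Qed.

(** The first factor is a subobject of [F], so its phase is at most that of [F];
    the last factor has the smallest phase of all. *)
Lemma semistable_last_factor_le F F' s :
  semistable phi F -> harder_narasimhan phi F (rcons s F') -> phi F' <= phi F.
Proof.
move=> [F0 Fss] HN; have := harder_narasimhan_last_le HN; have [Fs ss _] := HN.
case: s => [|G s] in HN Fs ss *.
  have [f fm] := filtration_sub Fs.
  move: ss => /(@Forall_rcons _ _ [::])[_ [F'0 _]] _.
  exact: Fss fm F'0.
have [f fm] := filtration_sub Fs.
move=> H; inversion_clear H as [|x y F'G _]; inversion_clear ss as [|x y Gss _].
by apply: le_trans F'G _; apply: Fss fm _; case: Gss.
Qed.

Lemma semistable_torsion_ge F p : semistable phi F -> p <= phi F ->
  torsion_ge phi p F.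
Proof.
move=> Fss pF; right; split; first by case: Fss.
by exists F; split=> //; exists [::]; exact: semistable_harder_narasimhan.
Qed.

(** A minimal extending object [N] of [T_(>= p)] lies in [T_(>= p')] only by
    being semistable of phase in [p', p): otherwise its maximally destabilizing
    quotient would be a proper factor, hence in [T_(>= p)], and then so would
    [N] be. *)
Lemma minimal_extending_phase N p p' :
  ~ is_zero N -> minimal_extending (torsion_ge phi p) N ->
  torsion_ge phi p' N -> p' <= phi N /\ phi N < p.
Proof.
move=> N0 [Nfac _ Nfree] [//|[_ [F [[s HN] p'F]]]].
have nTN : ~ torsion_ge phi p N by move=> /(Nfree N (idm N))/is_zeroP.
have [Ns /Forall_rcons[_ Fss] _] := HN.
have [L [f [q [fq _]]]] := filtration_rcons_inv Ns.
have [qiso|/(Nfac _ _ (ses_epi fq))] := EM (is_iso q).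
  have NF : isomorphic N F by exists q.
  rewrite (phi_iso N0 NF) ltNge; split=> //; apply/negP => pF.
  apply: nTN; apply: semistable_torsion_ge; last by rewrite (phi_iso N0 NF).
  exact: semistable_isomorphic (isomorphic_sym NF) Fss.
case=> [F0|[_ [F' [[s' HN'] pF']]]]; first by case: Fss.
case: nTN; right; split=> //; exists F; split; first by exists s.
exact: le_trans pF' (semistable_last_factor_le Fss HN').
Qed.

(** * Maximal green sequences and phases *)

Section GreenSequence.
Variables (m : nat) (T : nat -> set A).
Hypothesis hT : maximal_green_sequence m T.

Lemma green_torsion i : (i <= m)%N -> torsion_class (T i).
Proof. by case: hT => _ _ + _; apply. Qed.

Lemma green_subset i j : (i <= j <= m)%N -> T i `<=` T j.
Proof.
move=> /andP[ij jm]; elim: j ij jm => [|j IH].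
  by rewrite leqn0 => /eqP -> _; exact: subset_refl.
rewrite leq_eqVlt ltnS => /predU1P[-> _|ij jm]; first exact: subset_refl.
apply: subset_trans (IH ij (ltnW jm)) _.
by have [_ _ _ /(_ j jm)[_ _ [TjTj1 _] _]] := hT.
Qed.

Lemma green_zero i Z : (i <= m)%N -> is_zero Z -> T i Z.
Proof.
move=> im Z0; apply: (@green_subset 0); first by rewrite im.
by case: hT => ->.
Qed.

Lemma green_bottom X : T 0%N X -> is_zero X.
Proof. by case: hT => ->. Qed.

Section Crossing.
Variable N : nat -> A.
Hypothesis hN : hom_orthogonal_sequence m T N.
Hypothesis phi_dec : forall i, (0 < i < m)%N -> phi (N i.+1) < phi (N i).

Lemma green_factor_neq0 i : (i < m)%N -> ~ is_zero (N i.+1).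
Proof. by move=> /hN[[N1 _] _ _] /is_zeroP. Qed.

Lemma green_decomposition i X : (i < m)%N ->
  exists L Q (l : mor L X) (q : mor X Q),
    [/\ short_exact l q, T i L & torsion_free (T i) Q].
Proof.
move=> im; apply: (torsion_decomposition hab hlen).
  exact: green_torsion (ltnW im).
by move=> Z; exact: green_zero (ltnW im).
Qed.

Lemma phi_decreasing i j : (0 < i < j)%N -> (j <= m)%N -> phi (N j) < phi (N i).
Proof.
move=> /andP[i0 ij]; elim: j ij => // j IH; rewrite ltnS leq_eqVlt.
move=> /predU1P[<-|ij] jm; first by apply: phi_dec; rewrite i0.
apply: lt_trans (IH ij (ltnW jm)); apply: phi_dec.
by rewrite jm (leq_trans i0) // ltnW.
Qed.

(** Such objects, called layers below, are the subquotients of the filtration of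
    an object by its torsion parts for [T 0], [T 1], and so on. *)
Section Layer.
Variables (i : nat) (X : A).
Hypotheses (im : (i < m)%N) (TX : T i.+1 X) (Xfree : torsion_free (T i) X).

Lemma layer_slope : a X * b (N i.+1) = a (N i.+1) * b X.
Proof.
have [_ Nmin TF] := hN im.
have Tt : torsion_class (Filt (T i `|` [set N i.+1])).
  by rewrite -TF; exact: green_torsion.
have Tit := green_torsion (ltnW im).
have [||k wX] := minimal_extending_free hab hlen Tit _ Nmin Tt _ Xfree.
- by move=> Z; exact: green_zero (ltnW im).
- by rewrite -TF.
by rewrite (wX _ _ aD) (wX _ _ bD) mulrnAl mulrnAr.
Qed.

Hypothesis X0 : ~ is_zero X.

Lemma layer_phase : phi X = phi (N i.+1).
Proof.
apply/eqP; rewrite eq_phi ?layer_slope //; last exact: green_factor_neq0.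
Qed.

End Layer.

(** An object of [T i] is filtered by layers of phases [phi (N j)] with
    [j <= i], and these are at least [phi (N i)]. As a comparison of slopes the
    bound is additive in [X], and it also makes sense when [X] is zero. *)
Lemma green_slope_ge i X : (0 < i <= m)%N -> T i X ->
  a X * b (N i) <= a (N i) * b X.
Proof.
elim: i X => // i IH X /= im TX.
have [L [Q [l [q [lq TL Qfree]]]]] := green_decomposition X im.
have TQ := torsion_factor (green_torsion im) (ses_epi lq) TX.
suff : a L * b (N i.+1) <= a (N i.+1) * b L.
  by rewrite (aD lq) (bD lq) mulrDl mulrDr (layer_slope im TQ Qfree) lerD2r.
have [L0|L0] := EM (is_zero L).
  by rewrite (additive_function0 aD L0) (additive_function0 bD L0) mul0r mulr0.
case: i => [|i] in IH im TX TL TQ Qfree *; first by case: L0; exact: green_bottom.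
rewrite -le_phi //; last exact: green_factor_neq0.
apply: (@le_trans _ _ (phi (N i.+1))); first exact/ltW/phi_dec.
rewrite le_phi ?IH //; [exact: ltnW|exact: green_factor_neq0 (ltnW im)].
Qed.

(** The factor by a subobject is in [T i.+1], hence of phase at least that of
    [N i.+1], which is that of [X]; so the subobject has at most this phase. *)
Lemma layer_semistable i X : (i < m)%N -> T i.+1 X -> torsion_free (T i) X ->
  ~ is_zero X -> semistable phi X.
Proof.
move=> im TX Xfree X0; split=> // L f fm L0.
have [Q [q fq]] := mono_ses hab fm.
have TQ := torsion_factor (green_torsion im) (ses_epi fq) TX.
rewrite (layer_phase im TX Xfree X0) le_phi //; last exact: green_factor_neq0.
have := layer_slope im TX Xfree; have := green_slope_ge (i := i.+1) im TQ.
by rewrite (aD fq) (bD fq) => ? ?; lra.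
Qed.

(** The layers of [X] are its Harder-Narasimhan factors; the bound on the last
    one lets the induction add a layer of smaller phase. *)
Lemma green_harder_narasimhan i X : (0 < i <= m)%N -> T i X -> ~ is_zero X ->
  exists s F, harder_narasimhan phi X (rcons s F) /\ phi (N i) <= phi F.
Proof.
elim: i X => // i IH X /= im TX X0.
have [L [Q [l [q [lq TL Qfree]]]]] := green_decomposition X im.
have TQ := torsion_factor (green_torsion im) (ses_epi lq) TX.
have [L0|L0] := EM (is_zero L).
  have QX : isomorphic Q X.
    by apply: isomorphic_sym; exists q; exact: ses_iso_quot lq L0.
  have Q0 := isomorphic_nonzero (isomorphic_sym QX) X0.
  exists [::], X; split.
    apply: semistable_harder_narasimhan; apply: (semistable_isomorphic QX).
    exact: layer_semistable TQ Qfree Q0.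
  by rewrite -(phi_iso Q0 QX) (layer_phase im TQ Qfree Q0).
case: i => [|i] in IH im TX TL TQ Qfree *; first by case: L0; exact: green_bottom.
have im' : (0 < i.+1 <= m)%N by exact: ltnW.
have NN : phi (N i.+2) < phi (N i.+1) by exact: phi_dec.
have [Q0|Q0] := EM (is_zero Q).
  have LX : isomorphic L X by exists l; exact: ses_iso_sub lq Q0.
  have [|s [F [HN FN]]] := IH X im' _ X0.
    have Tt := green_torsion (ltnW im).
    exact: (torsion_iso Tt LX TL).
  by exists s, F; split=> //; apply: le_trans FN; exact: ltW.
have [s [F [[Ls ss sF] FN]]] := IH L im' TL L0.
have Qphi := layer_phase im TQ Qfree Q0.
exists (rcons s F), Q; split; last by rewrite Qphi.
split; first exact: FiltrationS lq Ls.
  by apply/Forall_rcons; split=> //; exact: layer_semistable TQ Qfree Q0.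
have FQ : phi F > phi Q by rewrite Qphi; exact: lt_le_trans FN.
case: s => [|G s] in Ls ss sF *; first by rewrite /= FQ.
by rewrite /= rcons_path last_rcons FQ andbT.
Qed.

(** The top layer of an object outside [T i] is a quotient of it whose phase is
    some [phi (N j)] with [i < j]; this is too small a phase for a quotient of
    [F]. *)
Lemma semistable_green i p F : (i <= m)%N ->
  (forall j, (i < j <= m)%N -> phi (N j) < p) ->
  semistable phi F -> p <= phi F -> T i F.
Proof.
move=> im pN Fss pF; apply: contrapT => nTF.
have exj : exists j, (j <= m)%N && `[< T j F >].
  by exists m; rewrite leqnn; apply/asboolP; case: hT => _ ->.
case: (ex_minnP exj) => j /andP[jm /asboolP TF] jmin.
have ij : (i < j)%N.
  rewrite ltnNge; apply/negP => ji; apply: nTF.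
  by apply: green_subset TF; rewrite ji.
case: j => // j in jm TF jmin ij *.
have [L [Q [l [q [lq TL Qfree]]]]] := green_decomposition F jm.
have TQ := torsion_factor (green_torsion jm) (ses_epi lq) TF.
have Q0 : ~ is_zero Q.
  move=> Q0; suff /jmin : (j <= m)%N && `[< T j F >] by rewrite ltnn.
  rewrite ltnW //; apply/asboolP.
  have LF : isomorphic L F by exists l; exact: ses_iso_sub lq Q0.
  have Tt := green_torsion (ltnW jm).
  exact: (torsion_iso Tt LF TL).
have := semistable_quotient Fss (ses_epi lq) Q0.
rewrite (layer_phase jm TQ Qfree Q0) leNgt => /negP; apply.
by apply: lt_le_trans pF; apply: pN; rewrite ij.
Qed.

Lemma torsion_ge_green i p : (i <= m)%N ->
  ((0 < i)%N -> p <= phi (N i)) ->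
  (forall j, (i < j <= m)%N -> phi (N j) < p) ->
  torsion_ge phi p = T i.
Proof.
move=> im pi pN; apply/seteqP; split=> X.
  case=> [X0|[X0 [F [[s HN] pF]]]]; first exact: green_zero.
  have [Xs ss _] := HN; have sF := harder_narasimhan_last_le HN.
  apply: filtration_torsion (green_torsion im) _ Xs _.
    by move=> Z; exact: green_zero.
  apply: Forall_impl (Forall_and ss sF) => G [Gss FG].
  by apply: (semistable_green im pN Gss); exact: le_trans pF FG.
move=> TX; have [X0|X0] := EM (is_zero X); first by left.
have i0 : (0 < i)%N.
  by rewrite lt0n; apply/eqP => iE; apply: X0; apply: green_bottom; rewrite -iE.
have [|s [F [HN NF]]] := green_harder_narasimhan (i := i) _ TX X0.
  by rewrite i0.
right; split=> //; exists F; split; first by exists s.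
exact: le_trans (pi i0) NF.
Qed.

(** The value [top] is a threshold above all phases, whose class is [T 0]. *)
Lemma crossing_induced (D : set R) (top : R) :
  D top -> (forall X, ~ is_zero X -> D (phi X) /\ phi X < top) ->
  induced_by D phi m T.
Proof.
move=> Dtop phiD; split; first by apply: slope_stability_function => X /phiD[].
apply/seteqP; split=> U [].
  move=> p Dp <-.
  pose good i := (i <= m)%N && ((i == 0%N) || (p <= phi (N i))).
  have exi : exists i, good i by exists 0%N.
  have good_le i : good i -> (i <= m)%N by move=> /andP[].
  case: (ex_maxnP exi good_le) => i /andP[im i_good] imax; exists i => //.
  apply/esym/torsion_ge_green => // [i0|j /andP[ij jm]].
    by move: i_good; rewrite (gtn_eqF i0).
  rewrite ltNge; apply/negP => pj; have := imax j.
  by rewrite /good jm pj orbT leqNgt ij => /(_ isT).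
move=> i /= im <-; case: i => [|i] in im *.
  exists top => //; apply: torsion_ge_green => // -[//|j] /= jm.
  by have [] := phiD _ (green_factor_neq0 jm).
exists (phi (N i.+1)); first by have [] := phiD _ (green_factor_neq0 im).
apply: torsion_ge_green => // j /andP[ij jm]; apply: phi_decreasing => //.
Qed.

End Crossing.

Lemma exists_hom_orthogonal_sequence :
  exists N : nat -> A, hom_orthogonal_sequence m T N.
Proof.
have [Z _] := has_zero hab.
have /choice[N hN] i : exists N, (i < m)%N ->
    [/\ brick N, minimal_extending (T i) N & T i.+1 = Filt (T i `|` [set N])].
  (* past the end of the sequence any object will do *)
  have [im|_] := boolP (i < m)%N; last by exists Z.
  have [_ _ _ /(_ i im) cov] := hT.
  have [|N hN] := cover_minimal_extending hab hlen cov; last by exists N.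
  by move=> Y; exact: green_zero (ltnW im).
by exists (fun i => N i.-1) => i im; exact: hN.
Qed.

Lemma induced_phase_decreasing (D : set R) (N : nat -> A) :
  induced_by D phi m T -> hom_orthogonal_sequence m T N ->
  forall i, (0 < i < m)%N -> phi (N i.+1) < phi (N i).
Proof.
move=> [_ TD] hN.
have Tge i : (i <= m)%N -> exists p, torsion_ge phi p = T i.
  move=> im; have : [set torsion_ge phi p | p in D] (T i) by rewrite TD; exists i.
  by case=> p _ <-; exists p.
have phase i : (i < m)%N -> forall p p',
    torsion_ge phi p = T i -> torsion_ge phi p' = T i.+1 ->
    p' <= phi (N i.+1) /\ phi (N i.+1) < p.
  move=> im p p' pE p'E; have [Nb Nmin TF] := hN i im.
  apply: minimal_extending_phase => //.
  - by case: Nb => + _ => N1 /is_zeroP.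
  - by rewrite pE.
  rewrite p'E TF; apply: (Filt_indecomposable hab); first by right.
  exact: brick_indecomposable.
case=> // i /= im.
have [p0 p0E] := Tge i (ltnW (ltnW im)).
have [p1 p1E] := Tge i.+1 (ltnW im).
have [p2 p2E] := Tge i.+2 im.
have [p1N _] := phase i (ltnW im) p0 p1 p0E p1E.
have [_ Np1] := phase i.+1 im p1 p2 p1E p2E.
exact: lt_le_trans Np1 p1N.
Qed.

End GreenSequence.
End SlopeStability.

(** * Central charges *)

Section Phase.
Variables (R : realType) (A : preadditive) (n : nat) (S : 'I_n -> A).
Hypotheses (hab : abelian A) (hlen : length_category A).
Hypothesis hS : enumerates_simples S.
Variables (alpha beta : 'rV[R]_n) (Z : {additive K0 A -> complex R}).
Hypothesis beta_gt0 : positive_vector beta.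
Hypothesis ZE : forall X,
  Z (K0class X) = (pairing S alpha X +i* pairing S beta X)%C.
Implicit Types X Y : A.

Lemma le_phase X Y : ~ is_zero X -> ~ is_zero Y ->
  (phase Z X <= phase Z Y) =
  (pairing S alpha Y * pairing S beta X <= pairing S alpha X * pairing S beta Y).
Proof.
move=> X0 Y0; rewrite /phase ler_pdivrMr ?pi_gt0 // divfK ?gt_eqF ?pi_gt0 //.
by rewrite !ZE le_arg //; exact: (pairing_gt0 hab hlen hS).
Qed.

Lemma phase_bounds X : ~ is_zero X -> phase Z X \in `[0, 1] /\ phase Z X < 1.
Proof.
move=> X0; have bX := pairing_gt0 hab hlen hS beta_gt0 X0.
have lt1 : phase Z X < 1.
  by rewrite /phase ltr_pdivrMr ?pi_gt0 // mul1r ZE arg_lt_pi.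
by rewrite in_itv /= (ltW lt1) andbT /phase divr_ge0 ?pi_ge0 // ZE arg_ge0.
Qed.

End Phase.

Theorem theorem3p7 (R : realType) (A : preadditive)
    (hab : abelian A) (hlen : length_category A)
    (n : nat) (S : 'I_n -> A) (hS : enumerates_simples S)
    (m : nat) (T : nat -> set A) (hT : maximal_green_sequence m T) :
  (exists Z : {additive K0 A -> complex R},
      central_charge S Z /\ induced_by_charge Z m T)
  <-> crossing_inequalities R S m T.
Proof.
have aD (theta : 'rV[R]_n) := pairing_additive hab hlen hS theta.
split=> [[Z [[alpha [beta [beta_gt0 ZE]]] Zind]]|].
  have phi_le := le_phase hab hlen hS beta_gt0 ZE.
  have [N hN] := exists_hom_orthogonal_sequence hab hlen hT.
  exists N; split=> //; exists alpha, beta; split=> // i im.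
  have N0 j : (0 < j <= m)%N -> ~ is_zero (N j).
    by case: j => // j /= jm; exact: (green_factor_neq0 hN).
  rewrite -(lt_phi phi_le); last 2 first.
  - by apply: N0; case/andP: im => _ ->.
  - by apply: N0; case/andP: im => -> /ltnW ->.
  exact: (induced_phase_decreasing hab (aD alpha) (aD beta) phi_le Zind hN).
case=> [N [hN [alpha [beta [beta_gt0 cross]]]]].
have [|Z ZE] := @K0_lift A (complex R)
    (fun X => (pairing S alpha X +i* pairing S beta X)%C).
  move=> L M Q f g fg; rewrite (aD alpha _ _ _ _ _ fg) (aD beta _ _ _ _ _ fg).
  by apply/eqP; rewrite eq_complex /= !eqxx.
exists Z; split; first by exists alpha, beta.
have phi_le := le_phase hab hlen hS beta_gt0 ZE.
apply: (crossing_induced hab hlen (aD alpha) (aD beta) phi_le hT hN _ (top := 1)).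
- move=> i im; rewrite (lt_phi phi_le) ?cross //; case/andP: im => i0 im.
    exact: (green_factor_neq0 hN).
  by case: i i0 im => // i _ /ltnW; exact: (green_factor_neq0 hN).
- by rewrite /= in_itv /= ler01 lexx.
- exact: (phase_bounds hab hlen hS beta_gt0 ZE).
Qed.
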